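(* Consider the primal problem (P): $\min_{s\in\mathbb{R}^n,\beta\in\mathbb{R}^p}\{L(s)+\lambda\Psi(\beta): X\beta-s-y=0\}$ and its dual (D): $\min_{w\in\mathbb{R}^n}\{\langle y,w\rangle+L^*(w)+\lambda\Psi^*(-\lambda^{-1}X^\top w)\}$. Run the following inexact proximal augmented Lagrangian method without termination: given $(w^0,s^0,\beta^0)$, $\sigma_0>0$, $\tau>0$ and a summable sequence $\{\delta_k\}$ of positive numbers with $\delta_k<1$, for $k=0,1,2,\dots$: compute $w^{k+1}$ as an approximate minimizer of $\psi_k(w)=\mathcal{L}_{\sigma_k}(w;s^k,\beta^k)+\frac{\tau}{2\sigma_k}\|w-w^k\|_2^2$; set $s^{k+1}=\sigma_k\operatorname{Prox}_L(s^k/\sigma_k+w^{k+1})$ and $\beta^{k+1}=\sigma_k\lambda\operatorname{Prox}_\Psi(\beta^k/(\sigma_k\lambda)-X^\top w^{k+1}/\lambda)$, where $w^{k+1}$ is required to satisfy $$\|\nabla\psi_k(w^{k+1})\|_2\le\frac{\delta_k\min(1,\sqrt\tau)}{\sigma_k}\min\{1,\|(\sqrt\tau w^{k+1},s^{k+1},\beta^{k+1})-(\sqrt\tau w^k,s^k,\beta^k)\|_2\};$$ then choose $\sigma_{k+1}\ge\sigma_k$. Then $\{(s^k,\beta^k)\}$ converges to an optimal solution of (P) and $\{w^k\}$ converges to an optimal solution of (D). Moreover, let $r>\sum_{k=0}^\infty\delta_k$ and let $\kappa>0$ be such that $\operatorname{dist}(z,\mathcal{T}^{-1}(0))\le\kappa\operatorname{dist}(0,\mathcal{T}(z))$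 for all $z=(w,s,\beta)$ with $\operatorname{dist}(z,\mathcal{T}^{-1}(0))\le r$. If $\operatorname{dist}((w^0,s^0,\beta^0),\mathcal{T}^{-1}(0))\le r-\sum_{k=0}^\infty\delta_k$, then for all $k$, $$\operatorname{dist}_{\mathcal{M}}\big((w^{k+1},s^{k+1},\beta^{k+1}),\mathcal{T}^{-1}(0)\big)\le\mu_k\operatorname{dist}_{\mathcal{M}}\big((w^k,s^k,\beta^k),\mathcal{T}^{-1}(0)\big),$$ where $\mu_k=(1-\delta_k)^{-1}\big(\delta_k+(1+\delta_k)\kappa\gamma/\sqrt{\sigma_k^2+\kappa^2\gamma^2}\big)$ and $\gamma=\max\{1,\tau\}$.
   Context: $X\in\mathbb{R}^{n\times p}$, $y\in\mathbb{R}^n$, $\lambda>0$. $L(s)=\frac{1}{n(n-1)}\sum_{i=1}^n\sum_{j\neq i}|s_i-s_j|$; $[p]$ is partitioned into nonempty disjoint groups $\mathcal{G}_1,\dots,\mathcal{G}_g$ with weights $w_l>0$ and $\Psi(\beta)=\sum_lw_l\|\beta_{\mathcal{G}_l}\|_2$. $f^*$ denotes the convex conjugate of $f$. For proper closed convex $f$ and $\sigma>0$, $e_\sigma f(x)=\min_u\{f(u)+\frac{1}{2\sigma}\|u-x\|_2^2\}$ is the Moreau envelope and $\operatorname{Prox}_{\sigma f}(x)$ its unique minimizer. The augmented Lagrangian is $\mathcal{L}_\sigma(w;s,\beta)=\langle y,w\rangle-e_\sigma L(s+\sigma w)+\frac{1}{2\sigma}\|s+\sigma w\|_2^2-\frac{1}{2\sigma}\|s\|_2^2-\lambda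 e_{\sigma\lambda}\Psi(\beta-\sigma X^\top w)+\frac{1}{2\sigma}\|\beta-\sigma X^\top w\|_2^2-\frac{1}{2\sigma}\|\beta\|_2^2$ (continuously differentiable in $w$). The maximal monotone operator $\mathcal{T}$ on $\mathbb{R}^n\times\mathbb{R}^n\times\mathbb{R}^p$ is $\mathcal{T}(w,s,\beta)=\{(w',s',\beta'): w'=y+s-X\beta,\ s'\in -w+\partial L(s),\ \beta'\in X^\top w+\partial(\lambda\Psi)(\beta)\}$, so $\mathcal{T}^{-1}(0)$ is the set of KKT points of (P)–(D). $\mathcal{M}=\operatorname{Diag}(\tau I_n,I_n,I_p)$, $\|x\|_{\mathcal{M}}=\sqrt{x^\top\mathcal{M}x}$, $\operatorname{dist}_{\mathcal{M}}(x,C)=\inf_{z\in C}\|x-z\|_{\mathcal{M}}$, and $\operatorname{dist}$ is the Euclidean distance. *)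

(* Defs.v *)
From HB Require Import structures.
From mathcomp Require Import all_boot all_order all_algebra.
From mathcomp Require Import all_classical all_reals all_analysis.
Set Implicit Arguments. Unset Strict Implicit. Unset Printing Implicit Defensive.
Import Order.TTheory GRing.Theory Num.Theory.
Import numFieldNormedType.Exports.
Local Open Scope classical_set_scope.
Local Open Scope ring_scope.

Section Defs.
Variable R : realType.

Definition dot (m : nat) (x y : 'cV[R]_m) : R := \sum_(i < m) x i 0 * y i 0.
Definition enorm (m : nat) (x : 'cV[R]_m) : R := Num.sqrt (dot x x).

Definition Lrank (n : nat) (s : 'cV[R]_n) : R :=
  (n%:R * (n%:R - 1))^-1 * \sum_(i < n) \sum_(j < n | j != i) `|s i 0 - s j 0|.

Definition Psi (p g : nat) (G : 'I_g -> {set 'I_p}) (wt : 'I_g -> R)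
  (b : 'cV[R]_p) : R :=
  \sum_(l < g) wt l * Num.sqrt (\sum_(i in G l) b i 0 ^+ 2).

Definition conj (m : nat) (f : 'cV[R]_m -> R) (x : 'cV[R]_m) : \bar R :=
  ereal_sup [set (dot x u - f u)%:E | u in [set: 'cV[R]_m]].

Definition menv (m : nat) (sigma : R) (f : 'cV[R]_m -> R) (x : 'cV[R]_m) : R :=
  inf [set f u + (2 * sigma)^-1 * enorm (u - x) ^+ 2 | u in [set: 'cV[R]_m]].

Definition prox (m : nat) (sigma : R) (f : 'cV[R]_m -> R) (x : 'cV[R]_m)
  : 'cV[R]_m :=
  xget 0 [set u | forall v, f u + (2 * sigma)^-1 * enorm (u - x) ^+ 2
                          <= f v + (2 * sigma)^-1 * enorm (v - x) ^+ 2].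

Definition subdiff (m : nat) (f : 'cV[R]_m -> R) (x : 'cV[R]_m) : set 'cV[R]_m :=
  [set v | forall u, f x + dot v (u - x) <= f u].

Definition grad (m : nat) (f : 'cV[R]_m -> R) (x : 'cV[R]_m) : 'cV[R]_m :=
  \col_(i < m) ('D_(delta_mx i 0) f x).

(* primal triples z = (w, s, beta) *)
Definition triple (n p : nat) := ('cV[R]_n * 'cV[R]_n * 'cV[R]_p)%type.

Definition tsub (n p : nat) (z z' : triple n p) : triple n p :=
  (z.1.1 - z'.1.1, z.1.2 - z'.1.2, z.2 - z'.2).

Definition tnorm (n p : nat) (z : triple n p) : R :=
  Num.sqrt (enorm z.1.1 ^+ 2 + enorm z.1.2 ^+ 2 + enorm z.2 ^+ 2).

(* ||z||_M with M = Diag(tau I_n, I_n, I_p) *)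
Definition Mnorm (n p : nat) (tau : R) (z : triple n p) : R :=
  Num.sqrt (tau * enorm z.1.1 ^+ 2 + enorm z.1.2 ^+ 2 + enorm z.2 ^+ 2).

Definition dist (n p : nat) (z : triple n p) (C : set (triple n p)) : R :=
  inf [set tnorm (tsub z z') | z' in C].

Definition distM (n p : nat) (tau : R) (z : triple n p) (C : set (triple n p)) : R :=
  inf [set Mnorm tau (tsub z z') | z' in C].

Definition dist0 (n p : nat) (S : set (triple n p)) : R :=
  inf [set tnorm v | v in S].

(* maximal monotone operator T of the KKT system *)
Definition Top (n p g : nat) (X : 'M[R]_(n, p)) (y : 'cV[R]_n) (lam : R)
  (G : 'I_g -> {set 'I_p}) (wt : 'I_g -> R) (z : triple n p) : set (triple n p) :=
  [set z' | z'.1.1 = y + z.1.2 - X *m z.2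
          /\ subdiff (@Lrank n) z.1.2 (z'.1.2 + z.1.1)
          /\ subdiff (fun b => lam * Psi G wt b) z.2 (z'.2 - X^T *m z.1.1)].

Definition Tinv0 (n p g : nat) (X : 'M[R]_(n, p)) (y : 'cV[R]_n) (lam : R)
  (G : 'I_g -> {set 'I_p}) (wt : 'I_g -> R) : set (triple n p) :=
  [set z | Top X y lam G wt z (0, 0, 0)].

Definition primal_opt (n p g : nat) (X : 'M[R]_(n, p)) (y : 'cV[R]_n) (lam : R)
  (G : 'I_g -> {set 'I_p}) (wt : 'I_g -> R) (s : 'cV[R]_n) (b : 'cV[R]_p) : Prop :=
  X *m b - s - y = 0 /\
  forall s' b', X *m b' - s' - y = 0 ->
    Lrank s + lam * Psi G wt b <= Lrank s' + lam * Psi G wt b'.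

Definition dual_obj (n p g : nat) (X : 'M[R]_(n, p)) (y : 'cV[R]_n) (lam : R)
  (G : 'I_g -> {set 'I_p}) (wt : 'I_g -> R) (w : 'cV[R]_n) : \bar R :=
  ((dot y w)%:E + conj (@Lrank n) w
    + lam%:E * conj (Psi G wt) (- (lam^-1 *: (X^T *m w))))%E.

Definition dual_opt (n p g : nat) (X : 'M[R]_(n, p)) (y : 'cV[R]_n) (lam : R)
  (G : 'I_g -> {set 'I_p}) (wt : 'I_g -> R) (w : 'cV[R]_n) : Prop :=
  forall w', (dual_obj X y lam G wt w <= dual_obj X y lam G wt w')%E.

Definition auglag (n p g : nat) (X : 'M[R]_(n, p)) (y : 'cV[R]_n) (lam : R)
  (G : 'I_g -> {set 'I_p}) (wt : 'I_g -> R) (sigma : R)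
  (s : 'cV[R]_n) (b : 'cV[R]_p) (w : 'cV[R]_n) : R :=
  dot y w - menv sigma (@Lrank n) (s + sigma *: w)
  + (2 * sigma)^-1 * enorm (s + sigma *: w) ^+ 2 - (2 * sigma)^-1 * enorm s ^+ 2
  - lam * menv (sigma * lam) (Psi G wt) (b - sigma *: (X^T *m w))
  + (2 * sigma)^-1 * enorm (b - sigma *: (X^T *m w)) ^+ 2
  - (2 * sigma)^-1 * enorm b ^+ 2.

End Defs.

(* Main.v *)
(** The iterates form an inexact proximal point sequence for the KKT operator T
    in the M-inner product: the gradient of psi_k at w^(k+1) is
    y + s^(k+1) - X beta^(k+1) + (tau / sigma_k) (w^(k+1) - w^k), so that
    M (z^k + e^k - z^(k+1)) / sigma_k lies in T z^(k+1), where
    e^k = ((sigma_k / tau) grad psi_k, 0, 0) satisfies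
    |e^k|_M <= delta_k min(1, |z^(k+1) - z^k|_M).  Fejer monotonicity up to the
    summable errors bounds the sequence and makes its residuals vanish; a cluster
    point is a zero of T because the graph of T is closed, and Fejer monotonicity
    with respect to this zero yields convergence.  T has a zero because its
    resolvents at 0 stay bounded as sigma grows (Psi is coercive and the
    subgradients of L are bounded).

    For the rate, the error bound is available in the Euclidean ball of radius r
    only, whereas the iterates are confined to the M-ball of radius sqrt(gamma) r.
    Iterating a short proximal step shows that outside the Euclidean ball the
    residual is still at least r / kappa, and this suffices because the rate is
    stated with gamma instead of sqrt(gamma). *)

Require Import Defs.
From HB Require Import structures.
From mathcomp Require Import all_boot all_order all_algebra.
From mathcomp Require Import all_classical all_reals all_analysis.
From mathcomp Require Import ring lra.
Import Order.TTheory GRing.Theory Num.Theory.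
Import numFieldNormedType.Exports.
Local Open Scope classical_set_scope.
Local Open Scope ring_scope.

(** * Inner products and Euclidean vectors *)

Section InnerProduct.
Set Implicit Arguments.
Unset Strict Implicit.
Variable R : realType.

(** Stands in for limits: an error linear in [e] may be dropped, and [e <= 1] lets quadratic errors
    be bounded by linear ones. *)
Lemma ler_addMeps (x y C : R) :
  (forall e, 0 < e -> e <= 1 -> x <= y + C * e) -> x <= y.
Proof.
move=> H; apply/ler_addgt0Pr => e e0.
have K0 : 0 < `|C| + e + 1 by have := normr_ge0 C; lra.
pose d := e / (`|C| + e + 1).
have d0 : 0 < d by apply: divr_gt0.
have d1 : d <= 1 by rewrite ler_pdivrMr // mul1r; have := normr_ge0 C; lra.
apply: (le_trans (H d d0 d1)); rewrite lerD2l.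
have : C * d <= `|C| * d by apply: ler_wpM2r; [exact: ltW | exact: ler_norm].
move=> /le_trans; apply.
have : d * (`|C| + e + 1) = e by rewrite /d mulfVK // gt_eqF.
by have := normr_ge0 C; nra.
Qed.

Variable V : lmodType R.

(** The form is an explicit argument because the Euclidean and the M-inner products live on the same
    space. *)
Record is_inner (ip : V -> V -> R) : Prop := IsInner {
  inner_sym : forall x y, ip x y = ip y x;
  inner_linear : forall a x y z, ip (a *: x + y) z = a * ip x z + ip y z;
  inner_ge0 : forall x, 0 <= ip x x }.

Definition nrm (ip : V -> V -> R) (x : V) : R := Num.sqrt (ip x x).

Variables (ip : V -> V -> R) (ipP : is_inner ip).
Local Notation N := (nrm ip).

Lemma ipC x y : ip x y = ip y x. Proof. exact: inner_sym. Qed.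

Lemma ipDl x y z : ip (x + y) z = ip x z + ip y z.
Proof. by rewrite -[x in LHS]scale1r inner_linear // mul1r. Qed.

Lemma ip0l x : ip 0 x = 0.
Proof. by have := ipDl 0 0 x; rewrite addr0; lra. Qed.

Lemma ipZl a x z : ip (a *: x) z = a * ip x z.
Proof. by rewrite -[a *: x]addr0 inner_linear // ip0l addr0. Qed.

Lemma ipNl x z : ip (- x) z = - ip x z.
Proof. by rewrite -scaleN1r ipZl mulN1r. Qed.

Lemma ipDr x y z : ip z (x + y) = ip z x + ip z y.
Proof. by rewrite ipC ipDl ![ip _ z]ipC. Qed.

Lemma ipZr a x z : ip z (a *: x) = a * ip z x.
Proof. by rewrite ipC ipZl ipC. Qed.

Lemma ipNr x z : ip z (- x) = - ip z x.
Proof. by rewrite ipC ipNl ipC. Qed.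

Definition ipE := (ipDl, ipDr, ipNl, ipNr, ipZl, ipZr).

Lemma nrm_ge0 x : 0 <= N x. Proof. exact: sqrtr_ge0. Qed.

Lemma sqr_nrm x : N x ^+ 2 = ip x x.
Proof. by rewrite sqr_sqrtr // inner_ge0. Qed.

Lemma nrm0 : N 0 = 0.
Proof. by rewrite /nrm ip0l sqrtr0. Qed.

Lemma nrmZ a x : N (a *: x) = `|a| * N x.
Proof.
by rewrite /nrm ipZl ipZr mulrA -expr2 sqrtrM ?sqr_ge0 // sqrtr_sqr.
Qed.

Lemma nrmN x : N (- x) = N x.
Proof. by rewrite -scaleN1r nrmZ normrN1 mul1r. Qed.

Lemma nrmBC x y : N (x - y) = N (y - x).
Proof. by rewrite -nrmN opprB. Qed.

Lemma cauchy_schwarz x y : ip x y <= N x * N y.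
Proof.
apply: (@ler_addMeps _ _ (N x + N y + 1)) => e e0 e1.
have [a0 b0] := (nrm_ge0 x, nrm_ge0 y).
have := sqr_nrm x; have := sqr_nrm y.
move: (N x) (N y) a0 b0 => a b a0 b0 yy xx.
(* Shifting both norms by [e] makes the division by [(a + e) * (b + e)] legitimate even if a norm
   vanishes. *)
have := inner_ge0 ipP ((b + e) *: x - (a + e) *: y).
rewrite !ipE (ipC y x) -xx -yy => h.
have hab : 0 < (a + e) * (b + e) by apply: mulr_gt0; lra.
suff : ip x y <= (a + e) * (b + e) by nra.
rewrite -(ler_pM2l hab).
have ha : a ^+ 2 <= (a + e) ^+ 2 by nra.
have hb : b ^+ 2 <= (b + e) ^+ 2 by nra.
have : (b + e) ^+ 2 * a ^+ 2 <= (b + e) ^+ 2 * (a + e) ^+ 2.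
  by apply: ler_wpM2l => //; exact: sqr_ge0.
have : (a + e) ^+ 2 * b ^+ 2 <= (a + e) ^+ 2 * (b + e) ^+ 2.
  by apply: ler_wpM2l => //; exact: sqr_ge0.
move=> h1 h2; lra.
Qed.

Lemma cauchy_schwarzN x y : - (N x * N y) <= ip x y.
Proof. by have := cauchy_schwarz (- x) y; rewrite ipNl nrmN; lra. Qed.

Lemma nrmD x y : N (x + y) <= N x + N y.
Proof.
rewrite -(@ler_pXn2r _ 2) ?nnegrE ?addr_ge0 ?nrm_ge0 //.
rewrite sqr_nrm !ipE (ipC y x) -!sqr_nrm.
have := cauchy_schwarz x y; lra.
Qed.

Lemma nrm_triangle z x y : N (x - y) <= N (x - z) + N (z - y).
Proof. by apply: le_trans (nrmD _ _); rewrite addrA subrK. Qed.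

Lemma nrmB_ge x y : N x - N y <= N (x - y).
Proof. by have := nrmD (x - y) y; rewrite subrK; lra. Qed.

End InnerProduct.

(** * Euclidean spaces: compactness, existence of minimizers, linear maps *)

Section Euclidean.
Set Implicit Arguments.
Unset Strict Implicit.
Variable R : realType.

Lemma dotP m : is_inner (@dot R m).
Proof.
split=> [x y|a x y z|x]; rewrite /dot.
- by apply: eq_bigr => i _; rewrite mulrC.
- rewrite mulr_sumr -big_split /=; apply: eq_bigr => i _.
  by rewrite !mxE mulrDl mulrA.
- by apply: sumr_ge0 => i _; rewrite -expr2 sqr_ge0.
Qed.

Lemma enormE m (x : 'cV[R]_m) : enorm x = nrm (@dot R m) x.
Proof. by []. Qed.

Lemma enorm_ge0 m (x : 'cV[R]_m) : 0 <= enorm x. Proof. exact: sqrtr_ge0. Qed.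

Lemma sqr_enorm m (x : 'cV[R]_m) : enorm x ^+ 2 = dot x x.
Proof. exact: (sqr_nrm (@dotP m)). Qed.

Lemma enormN m (x : 'cV[R]_m) : enorm (- x) = enorm x.
Proof. exact: (nrmN (@dotP m)). Qed.

Lemma enormBC m (x y : 'cV[R]_m) : enorm (x - y) = enorm (y - x).
Proof. exact: (nrmBC (@dotP m)). Qed.

Lemma enormD m (x y : 'cV[R]_m) : enorm (x + y) <= enorm x + enorm y.
Proof. exact: (nrmD (@dotP m)). Qed.

Lemma enormZ m a (x : 'cV[R]_m) : enorm (a *: x) = `|a| * enorm x.
Proof. exact: (nrmZ (@dotP m)). Qed.

Lemma dot_geN m (x y : 'cV[R]_m) : - (enorm x * enorm y) <= dot x y.
Proof. exact: (cauchy_schwarzN (@dotP m)). Qed.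

Lemma coord_le_enorm m (x : 'cV[R]_m) i : `|x i 0| <= enorm x.
Proof.
rewrite -sqrtr_sqr ler_wsqrtr // expr2 /dot (bigD1 i) //= lerDl.
by apply: sumr_ge0 => j _; rewrite -expr2 sqr_ge0.
Qed.

Lemma enorm_le_coord m (x : 'cV[R]_m) : enorm x <= \sum_(i < m) `|x i 0|.
Proof.
have S0 : 0 <= \sum_(i < m) `|x i 0| by apply: sumr_ge0.
rewrite -(@ler_pXn2r _ 2) ?nnegrE ?enorm_ge0 // sqr_enorm.
rewrite expr2 mulr_suml; apply: ler_sum => i _.
rewrite -expr2 -real_normK ?num_real // expr2; apply: ler_wpM2l => //.
by rewrite (bigD1 i) //= lerDl; apply: sumr_ge0.
Qed.

Lemma fmap_ultra (S T : Type) (f : S -> T) (U : set_system S) :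
  UltraFilter U -> UltraFilter (f @ U).
Proof.
move=> UU; split; first exact: fmap_proper_filter.
move=> G GF sUG; rewrite predeqE => A; split; last exact: sUG.
move=> GA; have [//|UnA] := in_ultra_setVsetC (f @^-1` A) UU.
have GnA : G (~` A) by exact: sUG.
by have /filter_ex [? []] : G (A `&` ~` A) by exact: filterI.
Qed.

Lemma filter_forall_fin (T : Type) (I : finType) (F : set_system T)
    (P : I -> set T) :
  Filter F -> (forall i, F (P i)) -> F [set x | forall i, P i x].
Proof.
move=> FF FP; suff : F [set x | forall i, i \in enum I -> P i x].
  by apply: filterS => x h i; apply: h; rewrite mem_enum.
elim: (enum I) => [|i r IHr]; first by apply: filterE.
apply: filterS (filterI (FP i) IHr) => x [Pi h] j.
by rewrite inE => /predU1P[->|/h].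
Qed.

(** Along an ultrafilter finer than [\oo] every coordinate converges, by compactness of [[-B, B]];
    the vector of these limits is a cluster point. *)
Lemma enorm_bolzano_weierstrass m (u : nat -> 'cV[R]_m) (B : R) :
  (forall k, enorm (u k) <= B) ->
  exists l, forall e, 0 < e -> forall K : nat, exists k : nat,
    (K <= k)%N /\ enorm (u k - l) < e.
Proof.
move=> uB.
have [U [UU sU]] := @ultraFilterLemma nat \oo _.
have coord i : exists l : R, u k i 0 @[k --> U] --> l.
  have := @segment_compact R (- B) B; rewrite compact_ultra.
  move=> /(_ (u k i 0 @[k --> U]) _); case.
  - exact: fmap_ultra.
  - apply: (filterE (F := U)) => k /=; rewrite in_itv /= -ler_norml.
    exact: le_trans (coord_le_enorm _ _) (uB k).
  - by move=> l [_ ?]; exists l.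
have [l lP] := choice coord.
exists (\col_i l i) => e e0 K.
pose d := e / m.+1%:R.
have d0 : 0 < d by apply: divr_gt0 => //; rewrite ltr0n.
have near_e : \forall k \near U, forall i, `|l i - u k i 0| < d.
  by apply: filter_forall_fin => i; exact: cvgr_dist_lt (lP i) _ d0.
have near_K : \forall k \near U, (K <= k)%N.
  by apply: sU; exists K.
have [k [ke kK]] := filter_ex (filterI near_e near_K).
exists k; split=> //.
apply: le_lt_trans (enorm_le_coord _) _.
have : \sum_(i < m) `|(u k - \col_i l i) i 0| <= \sum_(i < m) d.
  by apply: ler_sum => i _; rewrite !mxE distrC; exact: ltW.
move=> /le_lt_trans; apply; rewrite sumr_const card_ord -mulr_natl.
rewrite /d mulrC -mulrA gtr_pMr // mulrC ltr_pdivrMr ?ltr0n //.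
by rewrite mul1r ltr_nat.
Qed.

(** Coercivity bounds a minimizing sequence; the one-sided Lipschitz condition acts as lower
    semicontinuity at its cluster point. *)
Lemma coercive_has_min m (F : 'cV[R]_m -> R) (a c : R) :
  0 < a -> (forall u, a * enorm u ^+ 2 - c <= F u) ->
  (forall x, exists K, forall d, F x - K * enorm d <= F (x + d)) ->
  exists u, forall v, F u <= F v.
Proof.
move=> a0 Fco Flip.
pose S := [set F u | u in [set: 'cV[R]_m]].
have Slb : has_lbound S.
  exists (- c) => _ [u _ <-]; apply: le_trans (Fco u).
  by rewrite lerDr mulr_ge0 ?sqr_ge0 // ltW.
have Sinf : has_inf S by split=> //; exists (F 0); exists 0.
have minseq (k : nat) : exists u, F u <= inf S + k.+1%:R^-1.
  have [|_ [u _ <-] uk] := @inf_adherent _ S k.+1%:R^-1 _ Sinf.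
    by rewrite invr_gt0 ltr0n.
  by exists u; exact: ltW.
have [u uP] := choice minseq.
pose B := a^-1 * (inf S + 1 + c) + 1.
have uB k : enorm (u k) <= B.
  have h1 : a * enorm (u k) ^+ 2 <= inf S + 1 + c.
    have := Fco (u k); have := uP k.
    have : (k.+1%:R^-1 : R) <= 1 by rewrite invf_le1 ?ltr0n // ler1n.
    move: (k.+1%:R^-1) => t; lra.
  have h2 : enorm (u k) ^+ 2 <= a^-1 * (inf S + 1 + c).
    by rewrite mulrC ler_pdivlMr // mulrC.
  by rewrite /B; have := enorm_ge0 (u k); nra.
have [l lP] := enorm_bolzano_weierstrass uB.
exists l => v; apply: (@le_trans _ _ (inf S)); last by apply: ge_inf => //; exists v.
have [K KP] := Flip l.
apply: (@ler_addMeps _ _ _ (1 + `|K|)) => e e0 e1.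
have [N _ Ne] : \forall k \near \oo, (k.+1%:R^-1 : R) < e.
  have := cvgr_lt 0 (@cvg_harmonic R); apply; exact: e0.
have [k [Nk lk]] := lP e e0 N.
have := KP (u k - l); rewrite [l + _]addrC subrK => h.
have h1 := uP k; have : (k.+1%:R^-1 : R) < e := Ne k Nk.
move: (k.+1%:R^-1) h1 => t h1 h2.
have := enorm_ge0 (u k - l); have := ler_norm K; have := normr_ge0 K.
by nra.
Qed.

Lemma enorm_mulmx m q (A : 'M[R]_(m, q)) :
  exists2 K, 0 <= K & forall x : 'cV[R]_q, enorm (A *m x) <= K * enorm x.
Proof.
exists (\sum_(i < m) \sum_(j < q) `|A i j|) => [|x].
  by apply: sumr_ge0 => i _; apply: sumr_ge0.
apply: le_trans (enorm_le_coord _) _; rewrite mulr_suml.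
apply: ler_sum => i _; rewrite mxE mulr_suml.
apply: le_trans (ler_norm_sum _ _ _) _; apply: ler_sum => j _.
by rewrite normrM ler_wpM2l // coord_le_enorm.
Qed.

Lemma dot_trmx m q (A : 'M[R]_(m, q)) x w : dot (A^T *m w) x = dot w (A *m x).
Proof.
rewrite /dot; under eq_bigr do rewrite mxE mulr_suml.
rewrite exchange_big /=; apply: eq_bigr => i _; rewrite mxE mulr_sumr.
by apply: eq_bigr => j _; rewrite !mxE; ring.
Qed.

Lemma enorm_cvg m (u : nat -> 'cV[R]_m) (l : 'cV[R]_m) :
  (forall e, 0 < e -> exists K : nat, forall k : nat, (K <= k)%N ->
     enorm (u k - l) <= e) -> u @ \oo --> l.
Proof.
move=> H; apply/cvgrPdist_le => e e0.
have [K KP] := H e e0; exists K => // k /= Kk.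
rewrite [leLHS]/Num.norm /= mx_normrE; apply: bigmax_le => [|[i j] _ /=].
  exact: ltW.
rewrite ord1 -normrN -[- _]/(- (l - u k) i 0 ) ; have := KP k Kk.
apply: le_trans; apply: le_trans (coord_le_enorm _ i).
by rewrite !mxE opprB.
Qed.

End Euclidean.

(** * Sublinear functions, proximal points and Moreau envelopes *)

Section Sublinear.
Set Implicit Arguments.
Unset Strict Implicit.
Variable R : realType.

(** Common features of [Lrank] and [Psi]: the first two fields imply convexity, and subadditivity
    with the last one implies Lipschitz continuity. *)
Record sublinear m (f : 'cV[R]_m -> R) : Prop := Sublinear {
  subl_add : forall x y, f (x + y) <= f x + f y;
  subl_homo : forall t x, 0 <= t -> f (t *: x) = t * f x;
  subl_ge0 : forall x, 0 <= f x;
  subl_lip : exists2 C, 0 <= C & forall x, f x <= C * enorm x }.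

Lemma sublinear_Lrank n : sublinear (@Lrank R n).
Proof.
(* For [n = 0] the factor [n - 1] is negative, but the product is 0 and so is its inverse. *)
have c0 : 0 <= (n%:R * (n%:R - 1))^-1 :> R.
  rewrite invr_ge0; case: n => [|n]; first by rewrite mul0r.
  by rewrite mulr_ge0 ?ler0n // subr_ge0 ler1n.
rewrite /Lrank; move: (_^-1) c0 => c c0; split.
- move=> x y; rewrite -mulrDr ler_wpM2l // -big_split; apply: ler_sum => i _ /=.
  rewrite -big_split; apply: ler_sum => j _ /=; rewrite !mxE.
  by rewrite opprD addrACA ler_normD.
- move=> t x t0; rewrite mulrCA; congr (_ * _).
  rewrite mulr_sumr; apply: eq_bigr => i _; rewrite mulr_sumr.
  apply: eq_bigr => j _; rewrite !mxE -mulrBr normrM ger0_norm //.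
- by move=> x; rewrite mulr_ge0 // !sumr_ge0 // => i _; rewrite sumr_ge0.
- exists (c * \sum_(i < n) \sum_(j < n | j != i) 2) => [|x].
    by rewrite mulr_ge0 // !sumr_ge0 // => i _; rewrite sumr_ge0.
  rewrite -mulrA ler_wpM2l // mulr_suml; apply: ler_sum => i _.
  rewrite mulr_suml; apply: ler_sum => j _.
  apply: le_trans (ler_normB _ _) _.
  have := coord_le_enorm x i; have := coord_le_enorm x j; lra.
Qed.

Lemma sublinear_scale m (f : 'cV[R]_m -> R) (c : R) :
  0 <= c -> sublinear f -> sublinear (fun x => c * f x).
Proof.
move=> c0 [fD fZ f0 [C C0 fC]]; split=> [x y|t x t0|x|].
- by rewrite -mulrDr ler_wpM2l.
- by rewrite fZ // mulrCA.
- by rewrite mulr_ge0.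
- by exists (c * C) => [|x]; [rewrite mulr_ge0 | rewrite -mulrA ler_wpM2l].
Qed.

(** Zero padding turns a group norm into a Euclidean norm on the whole space, which supplies its
    triangle inequality. *)
Definition restrict p (A : {set 'I_p}) (b : 'cV[R]_p) : 'cV[R]_p :=
  \col_i (if i \in A then b i 0 else 0).

Lemma enorm_restrict p (A : {set 'I_p}) (b : 'cV[R]_p) :
  enorm (restrict A b) = Num.sqrt (\sum_(i in A) b i 0 ^+ 2).
Proof.
rewrite /enorm /dot [in RHS]big_mkcond; congr Num.sqrt.
by apply: eq_bigr => i _; rewrite mxE; case: ifP => _; rewrite ?mul0r ?expr2.
Qed.

Lemma sublinear_Psi p g (G : 'I_g -> {set 'I_p}) (wt : 'I_g -> R) :
  (forall l, 0 < wt l) -> sublinear (Psi G wt).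
Proof.
move=> wt0.
have PsiE b : Psi G wt b = \sum_(l < g) wt l * enorm (restrict (G l) b).
  by apply: eq_bigr => l _; rewrite enorm_restrict.
have wt_ge0 l : 0 <= wt l by exact: ltW.
split=> [x y|t x t0|x|].
- rewrite !PsiE -big_split; apply: ler_sum => l _ /=.
  rewrite -mulrDr ler_wpM2l //.
  have -> : restrict (G l) (x + y) = restrict (G l) x + restrict (G l) y.
    by apply/colP => i; rewrite !mxE; case: ifP => _; rewrite ?addr0.
  exact: (nrmD (@dotP R p)).
- rewrite !PsiE mulr_sumr; apply: eq_bigr => l _.
  have -> : restrict (G l) (t *: x) = t *: restrict (G l) x.
    by apply/colP => i; rewrite !mxE; case: ifP => _; rewrite ?mulr0.
  by rewrite enormE (nrmZ (@dotP R p)) ger0_norm // mulrCA.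
- by rewrite PsiE sumr_ge0 // => l _; rewrite mulr_ge0 // enorm_ge0.
- exists (\sum_(l < g) wt l) => [|x]; first by apply: sumr_ge0.
  rewrite PsiE mulr_suml; apply: ler_sum => l _; rewrite ler_wpM2l //.
  rewrite ler_wsqrtr // /dot; apply: ler_sum => i _; rewrite mxE.
  by case: ifP => // _; rewrite mulr0 -expr2 sqr_ge0.
Qed.

(** Coercivity of [Psi]: each coordinate lies in some group, hence is at most [Psi] divided by the
    positive weight of that group. *)
Lemma enorm_le_Psi p g (G : 'I_g -> {set 'I_p}) (wt : 'I_g -> R) :
  (forall l, 0 < wt l) -> (forall i : 'I_p, exists l, i \in G l) ->
  exists2 K, 0 <= K & forall b, enorm b <= K * Psi G wt b.
Proof.
move=> wt0 cover.
have wt_ge0 l : 0 <= wt l by exact: ltW.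
have t0 b l : 0 <= wt l * enorm (restrict (G l) b).
  by rewrite mulr_ge0 ?enorm_ge0.
exists (\sum_(i < p) \sum_(l < g) (wt l)^-1) => [|b].
  by apply: sumr_ge0 => i _; apply: sumr_ge0 => l _; rewrite invr_ge0.
apply: le_trans (enorm_le_coord _) _; rewrite mulr_suml.
apply: ler_sum => i _; have [l il] := cover i.
have h : `|b i 0| <= enorm (restrict (G l) b).
  by have := coord_le_enorm (restrict (G l) b) i; rewrite mxE il.
have h2 : wt l * enorm (restrict (G l) b) <= Psi G wt b.
  rewrite /Psi (bigD1 l) //= -enorm_restrict lerDl sumr_ge0 // => k _.
  by rewrite -enorm_restrict.
apply: le_trans h _; rewrite (bigD1 l) //= mulrDl.
apply: (@le_trans _ _ ((wt l)^-1 * Psi G wt b)).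
  by rewrite ler_pdivlMl.
rewrite lerDl; apply: mulr_ge0; last exact: le_trans (t0 b l) h2.
by apply: sumr_ge0 => k _; rewrite invr_ge0.
Qed.

Lemma subdiff_monotone m (f : 'cV[R]_m -> R) x x' v v' :
  subdiff f x v -> subdiff f x' v' -> 0 <= dot (v - v') (x - x').
Proof.
move=> /(_ x') h /(_ x) h'; have dP := @dotP R m.
by move: h h'; rewrite !(ipE dP); lra.
Qed.

Lemma subdiff_scale m (f : 'cV[R]_m -> R) (c : R) x v :
  0 <= c -> subdiff f x v -> subdiff (fun u => c * f u) x (c *: v).
Proof.
by move=> c0 fv u; rewrite (ipZl (@dotP R m)) -mulrDr ler_wpM2l.
Qed.

Variables (m : nat) (f : 'cV[R]_m -> R) (fP : sublinear f).
Let dP := @dotP R m.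

Lemma sublinear0 : f 0 = 0.
Proof. by have := subl_homo fP 0 (lexx 0); rewrite scale0r mul0r. Qed.

Lemma subdiff_dot_le x v u : subdiff f x v -> dot v u <= f u.
Proof.
move=> /(_ (x + u)); rewrite [x + u]addrC addrK.
by have := subl_add fP u x; lra.
Qed.

Lemma subdiff_dot_eq x v : subdiff f x v -> dot v x = f x.
Proof.
move=> fv; apply/eqP; rewrite eq_le (subdiff_dot_le _ fv) /=.
by have := fv 0; rewrite sublinear0 sub0r (ipNr dP); lra.
Qed.

(** Subgradients are characterised by [dot v u <= f u] for all [u] and [dot v x = f x]; the second
    condition is homogeneous in [x]. *)
Lemma subdiff_homo t x v : 0 <= t -> subdiff f x v -> subdiff f (t *: x) v.
Proof.
move=> t0 fv u; have := subdiff_dot_le u fv; have := subdiff_dot_eq fv.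
by rewrite (subl_homo fP) // !(ipE dP) => ->; lra.
Qed.

(** Testing a subgradient in its own direction gives [enorm v ^+ 2 <= f v <= C * enorm v]. *)
Lemma subdiff_bounded : exists2 C, 0 <= C &
  forall x v, subdiff f x v -> enorm v <= C.
Proof.
have [C C0 fC] := subl_lip fP; exists C => // x v fv.
have := subdiff_dot_le v fv; rewrite -sqr_enorm => /le_trans/(_ (fC v)).
have := enorm_ge0 v; rewrite le_eqVlt => /predU1P[<-//|v0].
by rewrite expr2 ler_pM2r.
Qed.

Lemma subdiff_closed x v :
  (forall e, 0 < e -> exists x' v',
     [/\ enorm (x' - x) < e, enorm (v' - v) < e & subdiff f x' v']) ->
  subdiff f x v.
Proof.
move=> H u; have [C C0 fC] := subl_lip fP.
apply: (@ler_addMeps _ _ _ (C + (enorm (u - x) + 1) + enorm v)) => e e0 e1.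
have [x' [v' [xe ve fv]]] := H e e0.
have h1 := fv u.
have h2 : f x <= f x' + C * e.
  have := subl_add fP x' (x - x'); rewrite addrC subrK.
  have := fC (x - x'); rewrite enormBC; nra.
have h3 := cauchy_schwarz dP (v - v') (u - x').
have h4 := nrm_triangle dP x u x'.
have h5 := cauchy_schwarz dP v (x' - x).
move: h3 h4 h5; rewrite -!enormE (enormBC v v') (enormBC x x').
move: h1; rewrite !(ipE dP) => h1 h3 h4 h5.
have a0 := enorm_ge0 (u - x'); have b0 := enorm_ge0 (u - x).
have c0 := enorm_ge0 v; have d0 := enorm_ge0 (v' - v).
have i1 : enorm (v' - v) * enorm (u - x') <= e * (enorm (u - x) + 1) by nra.
have i2 : enorm v * enorm (x' - x) <= enorm v * e by nra.
lra.
Qed.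

Variables (sigma : R) (sigma0 : 0 < sigma).

Definition is_prox x p := forall v,
  f p + (2 * sigma)^-1 * enorm (p - x) ^+ 2
    <= f v + (2 * sigma)^-1 * enorm (v - x) ^+ 2.

Let c0 : 0 < (2 * sigma)^-1.
Proof. by rewrite invr_gt0 mulr_gt0. Qed.

Let sigmaV : sigma^-1 = 2 * (2 * sigma)^-1.
Proof. by rewrite invfM mulrA divff ?mul1r. Qed.

Lemma is_prox_ex x : exists p, is_prox x p.
Proof.
have [C C0 fC] := subl_lip fP.
apply: (@coercive_has_min _ _ _ (2^-1 * (2 * sigma)^-1)
  ((2 * sigma)^-1 * enorm x ^+ 2)); first by rewrite mulr_gt0.
  move=> u; have := subl_ge0 fP u.
  rewrite !sqr_enorm !(ipE dP) (ipC dP x u).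
  (* This square yields [enorm (u - x) ^+ 2 >= enorm u ^+ 2 / 2 - enorm x ^+ 2], the source of the
     coercivity constants. *)
  have := inner_ge0 dP (u - 2 *: x); rewrite !(ipE dP) (ipC dP x u).
  move: (dot u u) (dot x u) (dot u x) (dot x x) c0 => a b b' d.
  move: ((2 * sigma)^-1) => c; nra.
move=> u; exists (C + 2 * (2 * sigma)^-1 * enorm (u - x)) => d.
have h1 : f u <= f (u + d) + C * enorm d.
  have := subl_add fP (u + d) (- d); rewrite addrK => /le_trans; apply.
  by rewrite lerD2l; apply: le_trans (fC _) _; rewrite enormN.
have := cauchy_schwarzN dP (u - x) d; rewrite -!enormE.
have -> : u + d - x = (u - x) + d by rewrite addrAC.
move: (u - x) => q; rewrite !sqr_enorm !(ipE dP) (ipC dP d q) => h2.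
have := inner_ge0 dP d; move: (enorm q) (enorm d) c0 h1 h2 => eq ed.
move: ((2 * sigma)^-1) => c c1 h1 h2 h3.
have : 0 <= c * dot d d by apply: mulr_ge0 => //; exact: ltW.
have : 0 <= c * (dot q d + eq * ed) by apply: mulr_ge0; [exact: ltW | lra].
lra.
Qed.

(** Compare [p] with [p + t *: (u - p)]: by convexity, dividing by [t] leaves the subgradient
    inequality up to an error of order [t]. *)
Lemma is_prox_subdiff x p : is_prox x p -> subdiff f p (sigma^-1 *: (x - p)).
Proof.
move=> pP u.
apply: (@ler_addMeps _ _ _ ((2 * sigma)^-1 * dot (u - p) (u - p))) => t t0 t1.
have := pP (p + t *: (u - p)).
have h : f (p + t *: (u - p)) <= (1 - t) * f p + t * f u.
  have -> : p + t *: (u - p) = (1 - t) *: p + t *: u.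
    by rewrite scalerBr scalerBl scale1r addrCA addrC.
  apply: le_trans (subl_add fP _ _) _.
  by rewrite !(subl_homo fP) // ?subr_ge0 // ltW.
have -> : p + t *: (u - p) - x = (p - x) + t *: (u - p) by rewrite addrAC.
have -> : x - p = - (p - x) by rewrite opprB.
move: (u - p) (p - x) h => d q h.
rewrite !sqr_enorm (ipZl dP) (ipNl dP) (ipDl dP) !(ipDr dP).
rewrite !(ipZl dP) !(ipZr dP) (ipC dP d q) sigmaV.
move: ((2 * sigma)^-1) c0 => c hc h1.
have : t * (f p + 2 * c * (- dot q d)) <= t * (f u + c * dot d d * t) by lra.
by rewrite ler_pM2l.
Qed.

Lemma subdiff_is_prox x p : subdiff f p (sigma^-1 *: (x - p)) -> is_prox x p.
Proof.
move=> h v; have := h v; rewrite sigmaV.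
have -> : v - x = (v - p) - (x - p) by rewrite opprB addrA subrK.
have -> : p - x = - (x - p) by rewrite opprB.
move: (v - p) (x - p) => a b.
rewrite !sqr_enorm !(ipE dP) (ipC dP a b).
have := inner_ge0 dP a; move: ((2 * sigma)^-1) c0 => c hc; nra.
Qed.

Lemma prox_subdiff x :
  subdiff f (prox sigma f x) (sigma^-1 *: (x - prox sigma f x)).
Proof. by apply: is_prox_subdiff; exact: (xgetPex _ (is_prox_ex x)). Qed.

Lemma menv_prox x p : is_prox x p ->
  menv sigma f x = f p + (2 * sigma)^-1 * enorm (p - x) ^+ 2.
Proof.
move=> pP; apply/eqP; rewrite eq_le; apply/andP; split.
  apply: ge_inf; last by exists p.
  by exists (f p + (2 * sigma)^-1 * enorm (p - x) ^+ 2) => _ [v _ <-].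
apply: lb_le_inf => [|_ [v _ <-]]; last exact: pP.
by exists (f p + (2 * sigma)^-1 * enorm (p - x) ^+ 2); exists p.
Qed.

Lemma menv_le_quad x : menv sigma f x <= (2 * sigma)^-1 * enorm x ^+ 2.
Proof.
have [p pP] := is_prox_ex x; rewrite (menv_prox pP).
by have := pP 0; rewrite sublinear0 add0r sub0r enormN.
Qed.

(* The convex function through which the augmented Lagrangian depends on the
   Moreau envelope; its gradient at x is the proximal point divided by sigma. *)
Definition menv_compl x := (2 * sigma)^-1 * enorm x ^+ 2 - menv sigma f x.

(** As a function of [x], [menv_compl] is a supremum over [u] of the affine functions [sigma^-1 *
    dot u x - f u - (2 * sigma)^-1 * enorm u ^+ 2], attained at the proximal point. *)
Lemma menv_compl_ge x p x' : is_prox x p ->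
  menv_compl x + sigma^-1 * dot p (x' - x) <= menv_compl x'.
Proof.
move=> pP; rewrite /menv_compl (menv_prox pP).
have [p' p'P] := is_prox_ex x'; rewrite (menv_prox p'P); have := p'P p.
rewrite sigmaV !sqr_enorm !(ipE dP) (ipC dP x p) (ipC dP x' p).
by move: ((2 * sigma)^-1) => c; lra.
Qed.

(** Exchanging the points in [menv_compl_ge] bounds the increment with the slope at [x']; firm
    nonexpansiveness of the proximal map controls the change of slope. *)
Lemma menv_compl_le x p x' : is_prox x p ->
  menv_compl x' <= menv_compl x + sigma^-1 * dot p (x' - x)
    + sigma^-1 * enorm (x' - x) ^+ 2.
Proof.
move=> pP; have [p' p'P] := is_prox_ex x'.
have h := menv_compl_ge x p'P.
have := subdiff_monotone (is_prox_subdiff p'P) (is_prox_subdiff pP).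
rewrite -scalerBr (ipZl dP) pmulr_rge0 ?invr_gt0 //.
have -> : x' - p' - (x - p) = (x' - x) - (p' - p).
  by apply/colP => i; rewrite !mxE; ring.
have e1 : dot p' (x' - x) = dot p (x' - x) + dot (p' - p) (x' - x).
  by rewrite -(ipDl dP) [p + _]addrC subrK.
have := inner_ge0 dP ((x' - x) - (p' - p)).
move: h; rewrite -(opprB x') (ipNr dP) e1 sqr_enorm.
move: (x' - x) (p' - p) => a b h.
rewrite !(ipE dP) (ipC dP a b) => h1 h2.
have : dot b a <= dot a a by lra.
have s0 : 0 < sigma^-1 by rewrite invr_gt0.
move=> h3; have : sigma^-1 * dot b a <= sigma^-1 * dot a a by rewrite ler_pM2l.
by lra.
Qed.
End Sublinear.

(** * Inexact proximal point iterations for an abstract monotone operator *)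

Section ProximalPoint.
Set Implicit Arguments.
Unset Strict Implicit.
Variable R : realType.

Lemma cvgn_cauchy_le (u : nat -> R) : cvgn u -> forall e, 0 < e ->
  exists K : nat, forall k m : nat, (K <= k)%N -> (K <= m)%N -> u k - u m <= e.
Proof.
move=> uc e e0.
have /cvgrPdist_le/(_ (e / 2)) [] := uc; first by rewrite divr_gt0.
move=> K _ KP; exists K => k m Kk Km.
have := KP k Kk; have := KP m Km; rewrite !ler_norml => /andP[h1 h2] /andP[h3 h4].
move: (limn u) h1 h2 h3 h4 => l; lra.
Qed.

Variables (V : lmodType R) (ip : V -> V -> R) (ipP : is_inner ip).
Local Notation N := (nrm ip).
Variable A : V -> V -> Prop.

Definition zero_dist z := inf [set N (z - z') | z' in [set z' | A z' 0]].

(** The relation [z' = (I + sigma A)^-1 z]. *)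
Definition resolvent sigma z z' := A z' (sigma^-1 *: (z - z')).

Hypothesis A_mono : forall z v z' v', A z v -> A z' v' -> 0 <= ip (v - v') (z - z').
Hypothesis A_res : forall sigma z, 0 < sigma -> exists z', resolvent sigma z z'.
(** Compactness of bounded sequences and closedness of the graph of [A] in one condition, phrased
    with [N] alone. *)
Hypothesis A_cluster : forall (z v : nat -> V) B,
  (forall k, N (z k) <= B) -> (forall k, A (z k) (v k)) ->
  (forall e, 0 < e -> exists K : nat, forall k, (K <= k)%N -> N (v k) <= e) ->
  exists2 l, A l 0 & forall e, 0 < e -> forall K : nat, exists k : nat,
    (K <= k)%N /\ N (z k - l) < e.
Hypothesis A_zero : exists z, A z 0.

Lemma zero_dist_le z z' : A z' 0 -> zero_dist z <= N (z - z').
Proof.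
move=> z0; apply: ge_inf; last by exists z'.
by exists 0 => _ [x _ <-]; exact: nrm_ge0.
Qed.

Lemma zero_dist_ge z c : (forall z', A z' 0 -> c <= N (z - z')) -> c <= zero_dist z.
Proof.
move=> h; have [x x0] := A_zero.
by apply: lb_le_inf => [|_ [z' z0 <-]]; [exists (N (z - x)); exists x | exact: h].
Qed.

Lemma zero_dist_ge0 z : 0 <= zero_dist z.
Proof. by apply: zero_dist_ge => z' _; exact: nrm_ge0. Qed.

Lemma zero_dist_lip x y : zero_dist x <= N (x - y) + zero_dist y.
Proof.
rewrite -lerBlDl; apply: zero_dist_ge => z' z0; rewrite lerBlDl.
exact: le_trans (zero_dist_le x z0) (nrm_triangle ipP _ _ _).
Qed.

(** Monotonicity gives [ip (z - z') (z' - x) >= 0], so expanding the square of the sum of these two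
    vectors loses only a nonnegative term. *)
Lemma resolvent_fejer sigma z z' x : 0 < sigma -> resolvent sigma z z' -> A x 0 ->
  N (z' - x) ^+ 2 + N (z - z') ^+ 2 <= N (z - x) ^+ 2.
Proof.
move=> s0 zz' x0; have := A_mono zz' x0.
rewrite subr0 (ipZl ipP) pmulr_rge0 ?invr_gt0 //.
have -> : z - x = (z - z') + (z' - x) by rewrite addrA subrK.
move: (z - z') (z' - x) => a b h; rewrite !(sqr_nrm ipP) !(ipE ipP) (ipC ipP b a).
lra.
Qed.

Lemma resolvent_nonexpansive sigma x x' y y' : 0 < sigma ->
  resolvent sigma x x' -> resolvent sigma y y' -> N (x' - y') <= N (x - y).
Proof.
move=> s0 xx' yy'; have := A_mono xx' yy'.
rewrite -scalerBr (ipZl ipP) pmulr_rge0 ?invr_gt0 //.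
have -> : x - x' - (y - y') = (x - y) - (x' - y').
  by rewrite !opprB addrACA [RHS]addrACA; congr (_ + _); rewrite addrC.
rewrite (ipDl ipP) (ipNl ipP) -(sqr_nrm ipP) => h.
have := cauchy_schwarz ipP (x - y) (x' - y').
have := nrm_ge0 ip (x - y); have := nrm_ge0 ip (x' - y').
move: (N (x' - y')) (N (x - y)) h => a b h a0 b0 h2.
have h3 : a * a <= b * a by rewrite -expr2; lra.
move: a0; rewrite le_eqVlt => /predU1P[<-//|a0].
by rewrite -(ler_pM2r a0).
Qed.

Lemma inexact_ppa_dist sigma z z' e x : 0 < sigma ->
  resolvent sigma (z + e) z' -> A x 0 -> N (z' - x) <= N (z - x) + N e.
Proof.
move=> s0 h x0; have := resolvent_fejer s0 h x0.
have h1 : N (z + e - x) <= N (z - x) + N e.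
  by rewrite addrAC; exact: nrmD.
move=> h2; apply: le_trans h1; have := sqr_ge0 (N (z + e - z')).
move=> h3; rewrite -(@ler_pXn2r _ 2) ?nnegrE ?nrm_ge0 //; lra.
Qed.

(** * Convergence of the inexact iteration *)

Section Convergence.
Variables (z e : nat -> V) (sigma delta : nat -> R).
Hypothesis sigma0 : 0 < sigma 0%N.
Hypothesis sigma_mono : forall k, sigma k <= sigma k.+1.
Hypothesis delta_sum : cvgn (series delta).
Hypothesis delta_ge0 : forall k, 0 <= delta k.
Hypothesis e_le : forall k, N (e k) <= delta k.
Hypothesis step : forall k, resolvent (sigma k) (z k + e k) (z k.+1).

Lemma sigma_ge_init k : sigma 0%N <= sigma k.
Proof. by elim: k => // k IH; exact: le_trans (sigma_mono k). Qed.

Lemma sigma_gt0 k : 0 < sigma k.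
Proof. exact: lt_le_trans (sigma_ge_init k). Qed.

Lemma series_delta_le k : series delta k <= limn (series delta).
Proof.
apply: nondecreasing_cvgn_le => //; apply/nondecreasing_seqP => m.
by rewrite seriesSr lerDl.
Qed.

(** Subtracting the accumulated errors turns quasi-Fejer monotonicity into plain monotonicity. *)
Lemma inexact_ppa_fejer x k m : A x 0 -> (k <= m)%N ->
  N (z m - x) - series delta m <= N (z k - x) - series delta k.
Proof.
move=> x0; elim: m => [|m IH]; first by rewrite leqn0 => /eqP->.
rewrite leq_eqVlt ltnS => /predU1P[->//|/IH]; apply: le_trans.
have := inexact_ppa_dist (sigma_gt0 m) (step m) x0; have := e_le m.
by rewrite seriesSr; lra.
Qed.

Theorem inexact_ppa_cvg : exists2 l, A l 0 &
  forall eps, 0 < eps -> exists K : nat, forall k : nat, (K <= k)%N -> N (z k - l) <= eps.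
Proof.
have [x x0] := A_zero.
pose b k := N (z k - x) - series delta k.
have b_cvg : cvgn b.
  apply: nonincreasing_is_cvgn.
    by move=> k m km; exact: inexact_ppa_fejer.
  exists (- limn (series delta)) => _ [k _ <-].
  by have := nrm_ge0 ip (z k - x); have := series_delta_le k; rewrite /b; lra.
pose S := limn (series delta).
have S0 : 0 <= S by have := series_delta_le 0; rewrite /series /= big_geq.
pose B := N (z 0%N - x) + S.
have B0 : 0 <= B by rewrite addr_ge0 // nrm_ge0.
have zB k : N (z k - x) <= B.
  have := inexact_ppa_fejer x0 (leq0n k); have := series_delta_le k.
  by rewrite {4}/series /= big_geq // /B /S; lra.
(* The Fejer inequality bounds the squared residual by a difference of squares, that is, by the
   decrement of the convergent sequence [b] times a bounded factor; hence the residuals vanish. *)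
have res_le k : N (z k + e k - z k.+1) ^+ 2 <= (b k - b k.+1) * (2 * B + S).
  have h := resolvent_fejer (sigma_gt0 k) (step k) x0.
  have h1 : N (z k + e k - x) <= N (z k - x) + delta k.
    by rewrite addrAC; apply: le_trans (nrmD ipP _ _) _; rewrite lerD2l.
  have h2 : N (z k + e k - x) ^+ 2 <= (N (z k - x) + delta k) ^+ 2.
    by rewrite ler_pXn2r ?nnegrE ?addr_ge0 ?nrm_ge0.
  have h3 := zB k; have h4 := zB k.+1.
  have h5 : delta k <= S.
    have := series_delta_le k.+1; rewrite seriesSr.
    have : 0 <= series delta k by apply: sumr_ge0.
    by rewrite /S; lra.
  have h6 : 0 <= b k - b k.+1 by rewrite subr_ge0; exact: inexact_ppa_fejer.
  have h7 : b k - b k.+1 = N (z k - x) + delta k - N (z k.+1 - x).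
    by rewrite /b seriesSr; ring.
  apply: (@le_trans _ _ ((b k - b k.+1) * (N (z k - x) + delta k + N (z k.+1 - x)))).
    by rewrite h7; lra.
  by apply: ler_wpM2l => //; lra.
pose v k := (sigma k)^-1 *: (z k + e k - z k.+1).
have [l l0 lP] : exists2 l, A l 0 & forall eps, 0 < eps -> forall K : nat,
    exists k : nat, (K <= k)%N /\ N (z k.+1 - l) < eps.
  apply: (@A_cluster (fun k => z k.+1) v (B + N x)) => // [k|eps eps0].
    by have := nrmB_ge ipP (z k.+1) x; have := zB k.+1; lra.
  pose c := (eps * sigma 0%N) ^+ 2 / (2 * B + S + 1).
  have D0 : 0 < 2 * B + S + 1 by lra.
  have es0 : 0 < eps * sigma 0%N by rewrite mulr_gt0.
  have c0 : 0 < c by rewrite divr_gt0 // exprn_gt0.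
  have [K KP] := cvgn_cauchy_le b_cvg c0; exists K => k Kk.
  have h := res_le k; have h1 := KP k k.+1 Kk (leqW Kk).
  have h6 : 0 <= b k - b k.+1 by rewrite subr_ge0; exact: inexact_ppa_fejer.
  have h2 : N (z k + e k - z k.+1) ^+ 2 <= (eps * sigma 0%N) ^+ 2.
    apply: le_trans h _.
    apply: (@le_trans _ _ (c * (2 * B + S + 1))).
      by apply: ler_pM => //; lra.
    by rewrite /c divfK // gt_eqF.
  rewrite ler_pXn2r ?nnegrE ?nrm_ge0 // in h2; last exact: ltW.
  rewrite /v (nrmZ ipP) gtr0_norm ?invr_gt0 ?sigma_gt0 //.
  rewrite ler_pdivrMl ?sigma_gt0 //; apply: le_trans h2 _.
  by rewrite mulrC ler_pM2r // sigma_ge_init.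
(* Half of [eps] covers the distance to [l] at one late index, the other half all later errors, by
   Fejer monotonicity with respect to [l]. *)
exists l => // eps eps0; have e20 : 0 < eps / 2 by rewrite divr_gt0.
have [K KP] := cvgn_cauchy_le delta_sum e20.
have [k [Kk kl]] := lP _ e20 K.
exists k.+1 => m km; have := inexact_ppa_fejer l0 km.
have := KP m k.+1 (leq_trans (leqW Kk) km) (leqW Kk); lra.
Qed.

End Convergence.

(* Along the proximal iteration with a step h such that h * N v <= r - kappa * N v
   the residual stays below N v, so the distance to the zeros cannot cross the gap
   between kappa * N v and r, although it tends to 0. *)
Lemma error_bound_extension r kappa z v : 0 < kappa ->
  (forall z v, A z v -> zero_dist z <= r -> zero_dist z <= kappa * N v) ->
  A z v -> r < zero_dist z -> r <= kappa * N v.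
Proof.
move=> k0 EB zv rz; rewrite leNgt; apply/negP => vr.
have v0 := nrm_ge0 ip v.
have v1 : 0 < N v + 1 by lra.
(* The denominator [N v + 1] keeps the step defined when [N v = 0]. *)
pose h := (r - kappa * N v) / (N v + 1).
have h0 : 0 < h by rewrite divr_gt0 // subr_gt0.
have hv : h * N v <= r - kappa * N v.
  have : h * (N v + 1) = r - kappa * N v by rewrite /h divfK // gt_eqF.
  by lra.
have [J JP] := choice (fun x => @A_res h x h0).
pose x k := iter k J z.
have inv k : exists w, [/\ A (x k) w, N w <= N v & r < zero_dist (x k)].
  elim: k => [|k [w [xw wv rx]]]; first by exists v.
  exists (h^-1 *: (x k - x k.+1)); have xw' := JP (x k).
  rewrite -[J (x k)]/(x k.+1) /resolvent in xw'.
  set w' := h^-1 *: _ in xw' *.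
  have dx : x k - x k.+1 = h *: w' by rewrite scalerA divff ?scale1r ?gt_eqF.
  (* Monotonicity between consecutive points gives [ip (w - w') w' >= 0], so residuals do not
     increase. *)
  have w'v : N w' <= N v.
    apply: le_trans wv; have := A_mono xw xw'.
    rewrite dx (ipZr ipP) pmulr_rge0 // (ipDl ipP) (ipNl ipP) -(sqr_nrm ipP).
    have := cauchy_schwarz ipP w w'; have := nrm_ge0 ip w'.
    rewrite le_eqVlt => /predU1P[<-|w0 h1 h2]; first by rewrite nrm_ge0.
    by rewrite -(ler_pM2r w0) -expr2; lra.
  split=> //; rewrite ltNge; apply/negP => rx'.
  have := EB _ _ xw' rx'; have := zero_dist_lip (x k) (x k.+1).
  rewrite dx (nrmZ ipP) gtr0_norm //; nra.
have [l l0 lP] : exists2 l, A l 0 & forall eps, 0 < eps -> exists K : nat,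
    forall k : nat, (K <= k)%N -> N (x k - l) <= eps.
  apply: (@inexact_ppa_cvg x (fun=> 0) (fun=> h) (fun=> 0)) => //.
  - rewrite (_ : series _ = cst 0); first exact: is_cvg_cst.
    by apply/funext => k; rewrite /series /= big1.
  - by move=> k; rewrite (nrm0 ipP).
  - by move=> k; rewrite addr0; exact: JP.
have r0 : 0 < r by apply: le_lt_trans vr; rewrite mulr_ge0 // ltW.
have [K KP] := lP r r0; have [w [_ _]] := inv K; rewrite ltNge => /negP; apply.
exact: le_trans (zero_dist_le _ l0) (KP K (leqnn K)).
Qed.

(** The exact step [q] from [z] contracts the distance by [eta / Num.sqrt (sigma ^+ 2 + eta ^+ 2)],
    from the Fejer inequality and the error bound at [q]; nonexpansiveness then compares [z'] with
    [q]. *)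
Lemma inexact_ppa_rate eta sigma delta z z' e :
  0 < eta -> 0 < sigma -> 0 < delta -> delta < 1 ->
  resolvent sigma (z + e) z' -> N e <= delta * N (z' - z) ->
  (forall q v, A q v -> zero_dist q <= zero_dist z -> zero_dist q <= eta * N v) ->
  zero_dist z' <= (1 - delta)^-1
    * (delta + (1 + delta) * eta / Num.sqrt (sigma ^+ 2 + eta ^+ 2)) * zero_dist z.
Proof.
move=> n0 s0 d0 d1 zz' ed EB.
have [q zq] := @A_res sigma z s0.
have D0 := zero_dist_ge0 z; have q0 := zero_dist_ge0 q.
have Nq0 := nrm_ge0 ip (z - q).
(* The Fejer inequality holds for every zero, so an infimum over zeros replaces the projection onto
   their set. *)
have pyth : zero_dist q ^+ 2 + N (z - q) ^+ 2 <= zero_dist z ^+ 2.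
  have S0 : 0 <= zero_dist q ^+ 2 + N (z - q) ^+ 2 by rewrite addr_ge0 ?sqr_ge0.
  rewrite -[leLHS]sqr_sqrtr // ler_pXn2r ?nnegrE ?sqrtr_ge0 //.
  apply: zero_dist_ge => x x0.
  rewrite -(@ler_pXn2r _ 2) ?nnegrE ?sqrtr_ge0 ?nrm_ge0 // sqr_sqrtr //.
  apply: le_trans (resolvent_fejer s0 zq x0); rewrite lerD2r.
  by rewrite ler_pXn2r ?nnegrE ?nrm_ge0 // zero_dist_le.
have Nq_le : N (z - q) <= zero_dist z.
  rewrite -(@ler_pXn2r _ 2) ?nnegrE //; have := sqr_ge0 (zero_dist q); lra.
have q_le : zero_dist q <= zero_dist z.
  rewrite -(@ler_pXn2r _ 2) ?nnegrE //; have := sqr_ge0 (N (z - q)); lra.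
have := EB _ _ zq q_le; rewrite (nrmZ ipP) gtr0_norm ?invr_gt0 // => h1.
have h2 : sigma * zero_dist q <= eta * N (z - q).
  by move: h1; rewrite mulrCA ler_pdivlMl.
set s := Num.sqrt _; have ss : s ^+ 2 = sigma ^+ 2 + eta ^+ 2.
  by rewrite sqr_sqrtr // addr_ge0 ?sqr_ge0.
have sp : 0 < s by rewrite sqrtr_gt0 ltr_pwDl ?exprn_gt0 ?sqr_ge0.
have h3 : zero_dist q <= eta / s * zero_dist z.
  rewrite mulrAC ler_pdivlMr // -(@ler_pXn2r _ 2) ?nnegrE ?mulr_ge0 ?(ltW sp) ?(ltW n0) //.
  rewrite !exprMn ss.
  have : (sigma * zero_dist q) ^+ 2 <= (eta * N (z - q)) ^+ 2.
    by rewrite ler_pXn2r ?nnegrE ?mulr_ge0 ?(ltW s0) ?(ltW n0).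
  have : eta ^+ 2 * (zero_dist q ^+ 2 + N (z - q) ^+ 2) <= eta ^+ 2 * zero_dist z ^+ 2.
    by rewrite ler_wpM2l ?sqr_ge0.
  by rewrite !exprMn; lra.
have h4 : N (z' - q) <= N e.
  have := resolvent_nonexpansive s0 zz' zq; by rewrite addrAC subrr add0r.
have h5 : N (z' - z) <= N (z' - q) + N (z - q).
  by rewrite (nrmBC ipP z q); exact: nrm_triangle.
have h6 := zero_dist_lip z' q.
have d1' : 0 < 1 - delta by lra.
(* The error is relative to [N (z' - z)], which itself contains [N (z' - q)]; solving for it creates
   the factor [1 - delta]. *)
have h7 : (1 - delta) * N (z' - q) <= delta * zero_dist z.
  have h8 : (1 - delta) * N (z' - z) <= zero_dist z by lra.
  have : delta * ((1 - delta) * N (z' - z)) <= delta * zero_dist z.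
    by rewrite ler_pM2l.
  have : (1 - delta) * N (z' - q) <= (1 - delta) * (delta * N (z' - z)).
    by rewrite ler_pM2l //; exact: le_trans h4 ed.
  by lra.
rewrite -mulrA ler_pdivlMl //.
have h8 : (1 - delta) * zero_dist z' <= (1 - delta) * (N (z' - q) + zero_dist q).
  by rewrite ler_pM2l.
have h9 : (1 - delta) * zero_dist q <= (1 - delta) * (eta / s * zero_dist z).
  by rewrite ler_pM2l.
(* The estimates give [1 - delta] in front of [eta / s]; this term passes to the weaker
   [1 + delta]. *)
have : 0 <= delta * (eta / s * zero_dist z).
  by rewrite !mulr_ge0 // ?invr_ge0 ltW.
rewrite -[(1 + delta) * eta / s]mulrA; move: (eta / s) h9 => t h9 h10; lra.
Qed.

End ProximalPoint.

(** * The KKT operator and the augmented Lagrangian *)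

Section Expansion.
Set Implicit Arguments.
Unset Strict Implicit.
Variables (R : realType) (m : nat).
Let dP := @dotP R m.

(** A subgradient inequality with a matching quadratic upper bound: it identifies [a] as the
    gradient at [w] and is stable under sums. *)
Definition expansion (F : 'cV[R]_m -> R) (w a : 'cV[R]_m) :=
  exists C, forall d, F w + dot a d <= F (w + d) <= F w + dot a d + C * enorm d ^+ 2.

Lemma expansion_grad F w a : expansion F w a -> grad F w = a.
Proof.
move=> [C FC]; apply/colP => i; rewrite mxE.
set v : 'cV[R]_m := delta_mx i 0.
have av : dot a v = a i 0.
  rewrite /dot (bigD1 i) //= big1 => [|j ji]; last by rewrite mxE (negbTE ji) mulr0.
  by rewrite mxE !eqxx mulr1 addr0.
rewrite -av; apply: cvg_lim => //; apply/cvgrPdist_le => e e0 /=.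
pose K := `|C| * enorm v ^+ 2 + 1.
have K0 : 0 < K by rewrite ltr_wpDl // mulr_ge0 ?sqr_ge0.
near=> h.
have h0 : h != 0 by near: h; exact: nbhs_dnbhs_neq.
have hK : `|h| * K <= e.
  rewrite -ler_pdivlMr //; near: h.
  apply: dnbhs0_le; exact: divr_gt0.
rewrite /= [h *: v + w]addrC.
have /andP[] := FC (h *: v); rewrite (ipZr dP) enormZ exprMn.
rewrite real_normK ?num_real // => h1 h2.
have -> : dot a v - h^-1 *: (F (w + h *: v) - F w)
    = h^-1 * (h * dot a v - (F (w + h *: v) - F w)).
  by rewrite mulrBr mulKf.
rewrite normrM normfV ler_pdivrMl ?normr_gt0 //.
have hh : h ^+ 2 = `|h| * `|h| by rewrite -expr2 real_normK ?num_real.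
have i1 : C * (h ^+ 2 * enorm v ^+ 2) <= `|h| * e.
  rewrite hh; apply: (@le_trans _ _ (`|h| * (`|h| * K))); last by rewrite ler_wpM2l.
  rewrite mulrCA -!mulrA ler_wpM2l // ler_wpM2l //.
  by rewrite /K ler_wpDr // ler_wpM2r ?sqr_ge0 // ler_norm.
by rewrite ler_norml; apply/andP; split; lra.
Unshelve. all: by end_near. Qed.

Lemma enorm_le0 (x : 'cV[R]_m) : enorm x <= 0 -> x = 0.
Proof.
move=> x0; apply/colP => i; rewrite mxE; apply/eqP.
by rewrite -normr_eq0 eq_le normr_ge0 andbT (le_trans (coord_le_enorm x i)).
Qed.

(** A step [- t *: a] would otherwise decrease [F], the quadratic error being of order [t ^+ 2]. *)
Lemma expansion_min F w a : expansion F w a -> (forall v, F w <= F v) -> a = 0.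
Proof.
move=> [C FC] wmin.
have : dot a a <= 0.
  apply: (@ler_addMeps _ _ _ (C * enorm a ^+ 2)) => t t0 t1.
  have /andP[_] := FC (- t *: a); have := wmin (w + - t *: a).
  rewrite (ipZr dP) enormZ exprMn normrN real_normK ?num_real // => h1 h2.
  rewrite add0r -(ler_pM2l t0); lra.
by move=> a0; apply: enorm_le0; rewrite /enorm ler0_sqrtr.
Qed.

Lemma expansionD F F' w a a' : expansion F w a -> expansion F' w a' ->
  expansion (fun v => F v + F' v) w (a + a').
Proof.
move=> [C FC] [C' FC']; exists (C + C') => d.
have /andP[h1 h2] := FC d; have /andP[h3 h4] := FC' d.
by rewrite (ipDl dP); apply/andP; split; lra.
Qed.

Lemma expansion_quad (c : R) w w0 : 0 <= c ->
  expansion (fun v => c * enorm (v - w0) ^+ 2) w ((2 * c) *: (w - w0)).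
Proof.
move=> c0; exists c => d; have -> : w + d - w0 = (w - w0) + d by rewrite addrAC.
move: (w - w0) => q; rewrite !sqr_enorm !(ipE dP) (ipC dP d q).
have : 0 <= c * dot d d by rewrite mulr_ge0 // inner_ge0.
by move=> h; apply/andP; split; lra.
Qed.

End Expansion.

Section Homogeneous.
Set Implicit Arguments.
Unset Strict Implicit.
Variable R : realType.

(** Subgradients at a point remain subgradients at its multiples; this links the scaled proximal
    updates of the algorithm to the Moreau envelopes. *)
Lemma is_prox_homo m (f : 'cV[R]_m -> R) sigma x : sublinear f -> 0 < sigma ->
  is_prox f sigma x (sigma *: prox 1 f (sigma^-1 *: x)).
Proof.
move=> fP s0; apply: subdiff_is_prox => //.
have := prox_subdiff fP ltr01 (sigma^-1 *: x).
rewrite invr1 scale1r => /(subdiff_homo fP (ltW s0)).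
by rewrite scalerBr scalerA mulVf ?gt_eqF // scale1r.
Qed.

End Homogeneous.

(** * Triples with the M-inner product; [tdot 1] is the Euclidean one *)

Section Triple.
Set Implicit Arguments.
Unset Strict Implicit.
Variables (R : realType) (n p : nat).
Local Notation triple := (triple R n p).

Definition tdot (tau : R) (z z' : triple) : R :=
  tau * dot z.1.1 z'.1.1 + dot z.1.2 z'.1.2 + dot z.2 z'.2.

Lemma tdotP tau : 0 <= tau -> is_inner (tdot tau).
Proof.
move=> t0; split=> [x y|a x y z|x]; rewrite /tdot.
- by rewrite !(ipC (@dotP R _) x.1.1) !(ipC (@dotP R _) x.1.2) (ipC (@dotP R _) x.2).
- by rewrite !(inner_linear (@dotP R _)); ring.
- by rewrite !addr_ge0 ?mulr_ge0 // inner_ge0 //; exact: dotP.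
Qed.

Lemma MnormE tau z : 0 <= tau -> Mnorm tau z = nrm (tdot tau) z.
Proof. by move=> t0; rewrite /Mnorm !sqr_enorm. Qed.

Lemma tnormE z : tnorm z = nrm (tdot 1) z.
Proof. by rewrite /tnorm !sqr_enorm /nrm /tdot mul1r. Qed.

Lemma tsubE (z z' : triple) : tsub z z' = z - z'.
Proof. by []. Qed.

Definition Mmul (tau : R) (z : triple) : triple := (tau *: z.1.1, z.1.2, z.2).

Lemma tnorm_Mmul_le tau z : 0 <= tau ->
  nrm (tdot 1) (Mmul tau z) <= Num.sqrt (Num.max 1 tau) * nrm (tdot tau) z.
Proof.
move=> t0; have m0 : 0 <= Num.max 1 tau by rewrite le_max ler01.
rewrite -sqrtrM // ler_wsqrtr // /tdot /= (ipZl (@dotP R n)) (ipZr (@dotP R n)).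
have [h1 h2] : 1 <= Num.max 1 tau /\ tau <= Num.max 1 tau by rewrite !le_max !lexx orbT.
have a0 := inner_ge0 (@dotP R n) z.1.1; have b0 := inner_ge0 (@dotP R n) z.1.2.
have c0 := inner_ge0 (@dotP R p) z.2.
move: (Num.max 1 tau) m0 h1 h2 => M m0 h1 h2; rewrite !mulrDr mul1r.
apply: lerD; [apply: lerD|].
- by rewrite ler_wpM2r // mulr_ge0.
- by rewrite ler_peMl.
- by rewrite ler_peMl.
Qed.

Lemma Mnorm_le_tnorm tau z : 0 <= tau ->
  nrm (tdot tau) z <= Num.sqrt (Num.max 1 tau) * nrm (tdot 1) z.
Proof.
move=> t0; have m0 : 0 <= Num.max 1 tau by rewrite le_max ler01.
rewrite -sqrtrM // ler_wsqrtr // /tdot mul1r.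
have [h1 h2] : 1 <= Num.max 1 tau /\ tau <= Num.max 1 tau by rewrite !le_max !lexx orbT.
have a0 := inner_ge0 (@dotP R n) z.1.1; have b0 := inner_ge0 (@dotP R n) z.1.2.
have c0 := inner_ge0 (@dotP R p) z.2.
move: (Num.max 1 tau) m0 h1 h2 => M m0 h1 h2; rewrite !mulrDr.
by apply: lerD; [apply: lerD; [rewrite ler_wpM2r|rewrite ler_peMl]|rewrite ler_peMl].
Qed.

Lemma tdot_components tau z : 0 < tau ->
  [/\ enorm z.1.1 <= (Num.sqrt tau)^-1 * nrm (tdot tau) z,
      enorm z.1.2 <= nrm (tdot tau) z & enorm z.2 <= nrm (tdot tau) z].
Proof.
move=> t0; have a0 := inner_ge0 (@dotP R n) z.1.1.
have b0 := inner_ge0 (@dotP R n) z.1.2; have c0 := inner_ge0 (@dotP R p) z.2.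
have ta0 : 0 <= tau * dot z.1.1 z.1.1 by rewrite mulr_ge0 // ltW.
split.
- rewrite ler_pdivlMl ?sqrtr_gt0 // -sqrtrM ?(ltW t0) // ler_wsqrtr // /tdot; lra.
- by rewrite ler_wsqrtr // /tdot; lra.
- by rewrite ler_wsqrtr // /tdot; lra.
Qed.

Lemma tnorm_le_components (z : triple) :
  nrm (tdot 1) z <= enorm z.1.1 + enorm z.1.2 + enorm z.2.
Proof.
have a0 := enorm_ge0 z.1.1; have b0 := enorm_ge0 z.1.2; have c0 := enorm_ge0 z.2.
rewrite -(@ler_pXn2r _ 2) ?nnegrE ?nrm_ge0 ?addr_ge0 //.
rewrite (sqr_nrm (tdotP ler01)) /tdot mul1r -!sqr_enorm; nra.
Qed.

Lemma triple_bolzano_weierstrass tau (z : nat -> triple) B : 0 < tau ->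
  (forall k, nrm (tdot tau) (z k) <= B) ->
  exists l, forall e, 0 < e -> forall K : nat, exists k : nat,
    (K <= k)%N /\ nrm (tdot tau) (z k - l) < e.
Proof.
move=> t0 zB.
have col_enorm a b (x : 'cV[R]_a) (x' : 'cV[R]_b) :
    dot (col_mx x x') (col_mx x x') = dot x x + dot x' x'.
  rewrite /dot big_split_ord /=; congr (_ + _); apply: eq_bigr => i _.
    by rewrite !col_mxEu.
  by rewrite !col_mxEd.
(* Stacking the blocks, the first one scaled by [Num.sqrt tau], makes the Euclidean norm of one
   vector equal to the M-norm. *)
pose u k : 'cV[R]_(n + (n + p)) :=
  col_mx (Num.sqrt tau *: (z k).1.1) (col_mx (z k).1.2 (z k).2).
have s2 : Num.sqrt tau * Num.sqrt tau = tau by rewrite -expr2 sqr_sqrtr // ltW.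
have [k|l lP] := @enorm_bolzano_weierstrass R _ u B.
  apply: le_trans (zB k).
  rewrite ler_wsqrtr // /u !col_enorm (ipZl (@dotP R n)) (ipZr (@dotP R n)).
  by rewrite mulrA s2 addrA.
exists ((Num.sqrt tau)^-1 *: usubmx l, usubmx (dsubmx l), dsubmx (dsubmx l)).
move=> e e0 K; have [k [Kk kl]] := lP e e0 K; exists k; split=> //.
apply: le_lt_trans kl; rewrite ler_wsqrtr //.
rewrite -[in leRHS](vsubmxK l) -[in leRHS](vsubmxK (dsubmx l)) /u.
rewrite !opp_col_mx !add_col_mx !col_enorm /tdot /=.
rewrite [leRHS]addrA !lerD2r.
have -> : Num.sqrt tau *: (z k).1.1 - usubmx l
    = Num.sqrt tau *: ((z k).1.1 - (Num.sqrt tau)^-1 *: usubmx l).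
  by rewrite scalerBr scalerA divff ?scale1r // gt_eqF // sqrtr_gt0.
by rewrite (ipZl (@dotP R n)) (ipZr (@dotP R n)) mulrA s2.
Qed.

End Triple.

(** * Monotonicity, closedness and resolvents of the KKT operator *)

Section Operator.
Set Implicit Arguments.
Unset Strict Implicit.
Variables (R : realType) (n p g : nat) (X : 'M[R]_(n, p)) (y : 'cV[R]_n).
Variables (lam : R) (G : 'I_g -> {set 'I_p}) (wt : 'I_g -> R).
Hypothesis lam0 : 0 < lam.
Hypothesis wt0 : forall l, 0 < wt l.
Local Notation triple := (triple R n p).
Local Notation T := (Top X y lam G wt).
Let nP := @dotP R n.
Let pP := @dotP R p.
Let LP := @sublinear_Lrank R n.
Let PsiP := sublinear_Psi G wt0.
Let lPsiP := sublinear_scale (ltW lam0) PsiP.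

(* The operator M^-1 T, which is monotone for the M-inner product [tdot tau]. *)
Definition TM (tau : R) (z v : triple) : Prop := T z (Mmul tau v).

Lemma Tinv0E tau : [set z | TM tau z 0] = Tinv0 X y lam G wt.
Proof. by rewrite /Tinv0 /TM /Mmul /= scaler0. Qed.

(** The linear part of [T] is skew and cancels; what remains is monotonicity of the two
    subdifferentials. *)
Lemma TM_monotone tau (z v z' v' : triple) : TM tau z v -> TM tau z' v' ->
  0 <= tdot tau (v - v') (z - z').
Proof.
case: z z' v v' => [[w s] b] [[w' s'] b'] [[v1 v2] v3] [[v1' v2'] v3'].
move=> [/= h1 [/= h2 h3]] [/= h1' [/= h2' h3']].
rewrite /tdot /= -(ipZl nP) scalerBr h1 h1'.
have := subdiff_monotone h2 h2'; have := subdiff_monotone h3 h3'.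
rewrite (_ : v2 + w - (v2' + w') = (v2 - v2') + (w - w')); last first.
  by rewrite opprD addrACA.
rewrite (_ : v3 - X^T *m w - (v3' - X^T *m w') = (v3 - v3') - X^T *m (w - w')); last first.
  by rewrite mulmxBr; apply/colP => i; rewrite !mxE; ring.
rewrite (_ : y + s - X *m b - (y + s' - X *m b') = (s - s') - X *m (b - b')); last first.
  by rewrite mulmxBr; apply/colP => i; rewrite !mxE; ring.
move: (v2 - v2') (v3 - v3') (s - s') (b - b') (w - w') => a c ds db dw.
rewrite !(ipE nP) !(ipE pP) dot_trmx (ipC nP ds dw) (ipC nP (X *m _)); lra.
Qed.

Lemma TM_cluster tau (z v : nat -> triple) B : 0 < tau ->
  (forall k, nrm (tdot tau) (z k) <= B) -> (forall k, TM tau (z k) (v k)) ->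
  (forall e, 0 < e -> exists K : nat, forall k, (K <= k)%N ->
     nrm (tdot tau) (v k) <= e) ->
  exists2 l, TM tau l 0 & forall e, 0 < e -> forall K : nat, exists k : nat,
    (K <= k)%N /\ nrm (tdot tau) (z k - l) < e.
Proof.
move=> t0 zB zv v0; have [l lP] := triple_bolzano_weierstrass t0 zB.
exists l => //.
have small e : 0 < e -> exists z' v', [/\ TM tau z' v',
    [/\ enorm (z'.1.1 - l.1.1) < e, enorm (z'.1.2 - l.1.2) < e
      & enorm (z'.2 - l.2) < e] &
    [/\ enorm v'.1.1 < e, enorm v'.1.2 < e & enorm v'.2 < e]].
  move=> e0; pose a := 1 + (Num.sqrt tau)^-1.
  have sV : 0 < (Num.sqrt tau)^-1 by rewrite invr_gt0 sqrtr_gt0.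
  have a0 : 0 < a by rewrite /a; lra.
  have ea : 0 < e / (2 * a) by rewrite divr_gt0 // mulr_gt0.
  have [K KP] := v0 _ ea; have [k [Kk kl]] := lP _ ea K.
  have ae N : N <= e / (2 * a) -> (Num.sqrt tau)^-1 * N < e /\ N < e.
    have : a * (2 * (e / (2 * a))) = e by field; rewrite gt_eqF.
    move: (e / (2 * a)) ea => t t0'; rewrite /a => eE Nt.
    have : (Num.sqrt tau)^-1 * N <= (Num.sqrt tau)^-1 * t by rewrite ler_pM2l.
    have : 0 < (Num.sqrt tau)^-1 * t by rewrite mulr_gt0.
    by split; lra.
  exists (z k), (v k); split; first exact: zv.
  - have [h1 h2 h3] := tdot_components (z k - l) t0.
    by have [] := ae _ (ltW kl); split; lra.
  - have [h1 h2 h3] := tdot_components (v k) t0.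
    by have [] := ae _ (KP k Kk); split; lra.
have [K K0 XK] := enorm_mulmx X; have [K' K'0 XK'] := enorm_mulmx X^T.
rewrite /TM /Mmul /= scaler0; split=> /=; last split.
- apply/esym/enorm_le0.
  apply: (@ler_addMeps _ _ _ (tau + 1 + K)) => e e0 e1.
  have [[[w s] b] [[[v1 v2] v3] [[/= h _] [_ /= sl bl] [/= v1e _ _]]]] := small e e0.
  have -> : y + l.1.2 - X *m l.2 = tau *: v1 - (s - l.1.2) + X *m (b - l.2).
    by rewrite h mulmxBr; apply/colP => i; rewrite !mxE; ring.
  apply: le_trans (enormD _ _) _; have := enormD (tau *: v1) (- (s - l.1.2)).
  rewrite enormN enormZ gtr0_norm //; have := XK (b - l.2); nra.
- apply: (subdiff_closed LP) => e e0; have e20 : 0 < e / 2 by rewrite divr_gt0.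
  have [[[w s] b] [[[v1 v2] v3] [[/= _ [h _]] [/= wl sl _] [/= _ v2e _]]]] := small _ e20.
  exists s, (v2 + w); split=> //; first lra.
  rewrite add0r -addrA; apply: le_lt_trans (enormD _ _) _; lra.
- apply: (subdiff_closed lPsiP) => e e0.
  (* The errors in [v3] and [X^T *m w] add up to at most [1 + K'] such units, strictly less than
     [e]. *)
  have eK : 0 < e / (2 + K') by rewrite divr_gt0 //; lra.
  have [[[w s] b] [[[v1 v2] v3] [[/= _ [_ h]] [/= wl _ bl] [/= _ _ v3e]]]] := small _ eK.
  have eE : e / (2 + K') * (2 + K') = e by rewrite divfK // gt_eqF //; lra.
  exists b, (v3 - X^T *m w); split=> //; first nra.
  have -> : v3 - X^T *m w - (0 - X^T *m l.1.1) = v3 - X^T *m (w - l.1.1).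
    by rewrite mulmxBr; apply/colP => i; rewrite !mxE; ring.
  apply: le_lt_trans (enormD _ _) _; rewrite enormN.
  have := XK' (w - l.1.1); nra.
Qed.

Definition psi (sigma tau : R) (z : triple) (v : 'cV[R]_n) : R :=
  auglag X y lam G wt sigma z.1.2 z.2 v + tau / (2 * sigma) * enorm (v - z.1.1) ^+ 2.

Lemma auglagE sigma s b v : 0 < sigma -> auglag X y lam G wt sigma s b v =
  dot y v + menv_compl (@Lrank R n) sigma (s + sigma *: v)
  + lam * menv_compl (Psi G wt) (sigma * lam) (b - sigma *: (X^T *m v))
  - (2 * sigma)^-1 * (enorm s ^+ 2 + enorm b ^+ 2).
Proof.
move=> s0; rewrite /auglag /menv_compl.
have -> : (2 * (sigma * lam))^-1 = lam^-1 * (2 * sigma)^-1.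
  by rewrite mulrA invfM mulrC.
by field; rewrite !gt_eqF.
Qed.

Section Step.
Variables (sigma tau : R) (z : triple).
Hypotheses (sigma0 : 0 < sigma) (tau0 : 0 < tau).
Let slam0 : 0 < sigma * lam. Proof. exact: mulr_gt0. Qed.

Lemma psi_expansion w q1 q2 :
  is_prox (@Lrank R n) sigma (z.1.2 + sigma *: w) q1 ->
  is_prox (Psi G wt) (sigma * lam) (z.2 - sigma *: (X^T *m w)) q2 ->
  expansion (psi sigma tau z) w
    ((y + q1 - X *m q2) + (tau / sigma) *: (w - z.1.1)).
Proof.
move=> q1P q2P.
have -> : tau / sigma = 2 * (tau / (2 * sigma)).
  by field; rewrite gt_eqF.
apply: expansionD; last first.
  by apply: expansion_quad; rewrite divr_ge0 ?mulr_ge0 // ltW.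
have [K K0 XK] := enorm_mulmx X^T.
(* The term of [Lrank] contributes [sigma], that of [Psi] contributes [sigma * K ^+ 2] through the
   bound on [X^T]. *)
exists (sigma + sigma * K ^+ 2) => d; rewrite !auglagE //.
have := menv_compl_ge LP sigma0 (z.1.2 + sigma *: (w + d)) q1P.
have := menv_compl_le LP sigma0 (z.1.2 + sigma *: (w + d)) q1P.
have := menv_compl_ge PsiP slam0 (z.2 - sigma *: (X^T *m (w + d))) q2P.
have := menv_compl_le PsiP slam0 (z.2 - sigma *: (X^T *m (w + d))) q2P.
have -> : z.1.2 + sigma *: (w + d) - (z.1.2 + sigma *: w) = sigma *: d.
  by apply/colP => i; rewrite !mxE; ring.
have -> : z.2 - sigma *: (X^T *m (w + d)) - (z.2 - sigma *: (X^T *m w))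
    = - (sigma *: (X^T *m d)).
  by rewrite mulmxDr; apply/colP => i; rewrite !mxE; ring.
rewrite enormN !enormZ !(gtr0_norm sigma0) (ipNr pP) !(ipZr nP) !(ipZr pP).
rewrite (ipC pP q2) dot_trmx (ipC nP d).
rewrite !(ipDl nP) (ipNl nP) (ipDr nP).
have -> : (sigma * lam)^-1 * - (sigma * dot (X *m q2) d) = - (lam^-1 * dot (X *m q2) d).
  by field; rewrite !gt_eqF.
have -> : (sigma * lam)^-1 * (sigma * enorm (X^T *m d)) ^+ 2
    = lam^-1 * (sigma * enorm (X^T *m d) ^+ 2).
  by field; rewrite !gt_eqF.
have -> : sigma^-1 * (sigma * enorm d) ^+ 2 = sigma * enorm d ^+ 2.
  by field; rewrite gt_eqF.
rewrite mulKf ?gt_eqF //.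
move: (menv_compl _ _ (z.2 - sigma *: (X^T *m (w + d)))) => A'.
move: (menv_compl _ _ (z.2 - sigma *: (X^T *m w))) => A.
move: (menv_compl _ _ _) (menv_compl _ _ _) => B B'.
rewrite -(ler_pM2l lam0) => h1.
rewrite -(ler_pM2l lam0) => h2 h3 h4.
move: h1 h2; rewrite !mulrDr !mulrN !mulVKf ?gt_eqF // => h1 h2.
have h5 : sigma * enorm (X^T *m d) ^+ 2 <= sigma * (K ^+ 2 * enorm d ^+ 2).
  by rewrite ler_pM2l // -exprMn ler_pXn2r ?nnegrE ?mulr_ge0 ?enorm_ge0.
by apply/andP; split; lra.
Qed.

(** Valid for every [w], minimizer or not: the gradient formula is the first component, with the
    gradient moved into the perturbation, and the optimality conditions of [q1] and [q2] are the
    other two. *)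
Lemma step_TM w q1 q2 :
  is_prox (@Lrank R n) sigma (z.1.2 + sigma *: w) q1 ->
  is_prox (Psi G wt) (sigma * lam) (z.2 - sigma *: (X^T *m w)) q2 ->
  resolvent (TM tau) sigma
    (z + ((sigma / tau) *: grad (psi sigma tau z) w, 0, 0) : triple) (w, q1, q2).
Proof.
move=> q1P q2P; rewrite (expansion_grad (psi_expansion q1P q2P)).
rewrite /resolvent /TM /Mmul /=; split; last split; rewrite /=.
- by apply/colP => i; rewrite !mxE; field; rewrite !gt_eqF.
- have := is_prox_subdiff LP sigma0 q1P.
  congr (subdiff _ _ _); apply/colP => i; rewrite !mxE; field; rewrite gt_eqF //.
- have := subdiff_scale (ltW lam0) (is_prox_subdiff PsiP slam0 q2P).
  congr (subdiff _ _ _); apply/colP => i; rewrite !mxE; field; rewrite !gt_eqF //.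
Qed.

Lemma psi_has_min : exists w, forall v, psi sigma tau z w <= psi sigma tau z v.
Proof.
pose t := tau / (2 * sigma).
have t0 : 0 < t by rewrite divr_gt0 // mulr_gt0.
apply: (@coercive_has_min _ _ _ (t / 4) (t * enorm z.1.1 ^+ 2 + t^-1 * enorm y ^+ 2
   + (2 * sigma)^-1 * (enorm z.1.2 ^+ 2 + enorm z.2 ^+ 2))); first by rewrite divr_gt0.
  move=> u; rewrite /psi auglagE // -/t.
  have h1 : 0 <= menv_compl (@Lrank R n) sigma (z.1.2 + sigma *: u).
    by rewrite subr_ge0 menv_le_quad.
  have h2 : 0 <= lam * menv_compl (Psi G wt) (sigma * lam) (z.2 - sigma *: (X^T *m u)).
    by rewrite mulr_ge0 ?(ltW lam0) // subr_ge0 menv_le_quad.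
  (* Young's inequality spends a quarter of [t * enorm u ^+ 2]; [h4] keeps a half, which leaves the
     coercivity constant [t / 4]. *)
  have h3 : - (t^-1 * enorm y ^+ 2 + t / 4 * enorm u ^+ 2) <= dot y u.
    have := inner_ge0 nP (y + (t / 2) *: u).
    rewrite !sqr_enorm !(ipE nP) (ipC nP u y) => h.
    have : 0 <= t^-1 * (dot y y + t / 2 * dot y u + (t / 2 * dot y u + t / 2 * (t / 2 * dot u u))).
      by rewrite mulr_ge0 ?invr_ge0 // ltW.
    rewrite (_ : t^-1 * _ = t^-1 * dot y y + dot y u + t / 4 * dot u u); first lra.
    by field; rewrite gt_eqF.
  have h4 : t * (enorm u ^+ 2 / 2 - enorm z.1.1 ^+ 2) <= t * enorm (u - z.1.1) ^+ 2.
    rewrite ler_pM2l //; have := inner_ge0 nP (u - 2 *: z.1.1).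
    rewrite !sqr_enorm !(ipE nP) (ipC nP u z.1.1); lra.
  lra.
move=> w.
have [q1 q1P] := is_prox_ex LP sigma0 (z.1.2 + sigma *: w).
have [q2 q2P] := is_prox_ex PsiP slam0 (z.2 - sigma *: (X^T *m w)).
have [C CP] := psi_expansion q1P q2P.
eexists => d; have /andP[h _] := CP d; apply: le_trans h.
rewrite lerD2l; exact: dot_geN.
Qed.

(** At an exact minimizer of [psi] the gradient is 0 and the perturbation in [step_TM] vanishes, so
    no appeal to Minty's theorem is made. *)
Lemma TM_resolvent : exists z', resolvent (TM tau) sigma z z'.
Proof.
have [w wmin] := psi_has_min.
have [q1 q1P] := is_prox_ex LP sigma0 (z.1.2 + sigma *: w).
have [q2 q2P] := is_prox_ex PsiP slam0 (z.2 - sigma *: (X^T *m w)).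
exists (w, q1, q2); have := step_TM q1P q2P.
rewrite (expansion_grad (psi_expansion q1P q2P)).
rewrite (expansion_min (psi_expansion q1P q2P) wmin) scaler0.
have -> : (0, 0, 0) = 0 :> triple by [].
by rewrite addr0 => h; exact h.
Qed.

End Step.
End Operator.

(** * KKT points *)

Section KKT.
Set Implicit Arguments.
Unset Strict Implicit.
Variables (R : realType) (n p g : nat) (X : 'M[R]_(n, p)) (y : 'cV[R]_n).
Variables (lam : R) (G : 'I_g -> {set 'I_p}) (wt : 'I_g -> R).
Hypothesis lam0 : 0 < lam.
Hypothesis wt0 : forall l, 0 < wt l.
Hypothesis cover : forall i : 'I_p, exists l, i \in G l.
Local Notation triple := (triple R n p).
Let nP := @dotP R n.
Let pP := @dotP R p.
Let LP := @sublinear_Lrank R n.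
Let lPsiP := sublinear_scale (ltW lam0) (sublinear_Psi G wt0).
Local Notation TM := (TM X y lam G wt).

(** Pairing the inclusions with [s] and [b] gives [lam * Psi b <= enorm w * enorm y], so [b] is
    bounded by a multiple of [w]. The equation bounds [s] by [w], and boundedness of the
    subgradients of [Lrank] bounds [w] by a constant plus [L^-1 * enorm s]. *)
Lemma resolvent0_bounded : exists B L0 : R, 0 < L0 /\
  forall (L : R) (z : triple), L0 <= L -> resolvent (TM 1) L 0 z -> nrm (tdot 1) z <= B.
Proof.
have [C C0 LC] := subdiff_bounded LP.
have [K K0 XK] := enorm_mulmx X.
have [P P0 PsiP] := enorm_le_Psi wt0 cover.
pose M := P / lam * enorm y.
have M0 : 0 <= M by rewrite mulr_ge0 ?enorm_ge0 // divr_ge0 // ltW.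
pose W := 2 * (C + enorm y).
exists (W + (enorm y + K * (M * W) + W) + M * W), (2 + 4 * (K * M)).
have KM0 : 0 <= K * M by rewrite mulr_ge0.
split=> [|L [[w s] b] LL]; first lra.
have L0 : 0 < L by lra.
rewrite /resolvent /TM /Mmul sub0r => -[/= h1 [/= h2 h3]].
have i0 : 0 < L^-1 by rewrite invr_gt0.
have iL : L * L^-1 = 1 by rewrite divff // gt_eqF.
(* The threshold on [L] makes the terms fed back into the bound on [enorm w] at most half of
   [enorm w], hence the factor 2 in [W]. *)
have i1 : L^-1 * (K * M) <= 1 / 4.
  by rewrite ler_pdivrMl // mulrC; lra.
have i2 : L^-1 <= 1 / 2 by rewrite -(ler_pM2l L0) iL; lra.
have wb := LC _ _ h2.
have e2 := subdiff_dot_eq LP h2; have e3 := subdiff_dot_eq lPsiP h3.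
have L_ge0 := subl_ge0 LP s.
move: e2 e3; rewrite !scalerN !(ipE nP) !(ipE pP) dot_trmx => e2 e3.
have Xb : X *m b = y + s + L^-1 *: w.
  have -> : L^-1 *: w = - (y + s - X *m b).
    by rewrite -h1 scale1r scalerN opprK.
  by rewrite opprB addrC subrK.
have lPb : lam * Psi G wt b <= enorm w * enorm y.
  rewrite -e3 Xb !(ipE nP); have := dot_geN w y.
  have : 0 <= L^-1 * dot b b by rewrite mulr_ge0 ?(ltW i0) // inner_ge0.
  have : 0 <= L^-1 * dot w w by rewrite mulr_ge0 ?(ltW i0) // inner_ge0.
  have : 0 <= L^-1 * dot s s by rewrite mulr_ge0 ?(ltW i0) // inner_ge0.
  lra.
have bM : enorm b <= M * enorm w.
  apply: le_trans (PsiP b) _.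
  have -> : M * enorm w = P * (lam^-1 * (enorm w * enorm y)) by rewrite /M; ring.
  by rewrite ler_wpM2l // ler_pdivlMl.
have ws : enorm w <= C + L^-1 * enorm s.
  have := enormD (L^-1 *: - s + w) (L^-1 *: s).
  rewrite enormZ (gtr0_norm i0) scalerN addrAC addNr add0r.
  by move: wb; rewrite scalerN; lra.
have sb : enorm s <= enorm y + K * (M * enorm w) + L^-1 * enorm w.
  have -> : s = (X *m b - y) - L^-1 *: w.
    by rewrite Xb; apply/colP => i; rewrite !mxE; ring.
  apply: le_trans (enormD _ _) _; rewrite enormN enormZ (gtr0_norm i0) lerD2r.
  apply: le_trans (enormD _ _) _; rewrite enormN addrC lerD2l.
  apply: le_trans (XK b) _; by rewrite ler_wpM2l.
have w0 := enorm_ge0 w; have y0 := enorm_ge0 y.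
have wW : enorm w <= W.
  have j1 : L^-1 * enorm s
      <= L^-1 * enorm y + L^-1 * (K * M) * enorm w + L^-1 * (L^-1 * enorm w).
    have : L^-1 * enorm s <= L^-1 * (enorm y + K * (M * enorm w) + L^-1 * enorm w).
      by rewrite ler_pM2l.
    by move: (L^-1) => i; lra.
  have j2 : L^-1 * enorm y <= enorm y by rewrite ler_piMl //; lra.
  have j3 : L^-1 * (K * M) * enorm w <= 1 / 4 * enorm w by rewrite ler_wpM2r.
  have j4 : L^-1 * (L^-1 * enorm w) <= 1 / 2 * (1 / 2 * enorm w).
    by apply: ler_pM => //; rewrite ?mulr_ge0 ?(ltW i0) // ler_wpM2r.
  by rewrite /W; move: (L^-1) ws j1 j2 j3 j4 => i; lra.
have MW : M * enorm w <= M * W by rewrite ler_wpM2l.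
have KMW : K * (M * enorm w) <= K * (M * W) by rewrite ler_wpM2l.
have iw : L^-1 * enorm w <= W by apply: le_trans wW; rewrite ler_piMl //; lra.
apply: le_trans (tnorm_le_components _) _ => /=.
by move: (L^-1) iw sb => i; lra.
Qed.

(** The residuals [- (L k)^-1 *: z k] of the bounded resolvents at 0 vanish as [L k] grows, so a
    cluster point is a zero. *)
Lemma TM_zero_ex tau : exists z : triple, TM tau z 0.
Proof.
suff [z z0] : exists z : triple, TM 1 z 0.
  by exists z; move: z0; rewrite /TM /Mmul /= !scaler0.
have [B [L0 [L0_gt0 LB]]] := resolvent0_bounded.
pose L (k : nat) := L0 + k.+1%:R.
have k0 (k : nat) : 0 < k.+1%:R :> R by rewrite ltr0n.
have L_gt0 k : 0 < L k by rewrite addr_gt0.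
have [z zP] := choice (fun k => TM_resolvent X y G lam0 wt0 0 (L_gt0 k) ltr01).
have zB k : nrm (tdot 1) (z k) <= B.
  by apply: LB (zP k); rewrite lerDl ltW.
have [|l l0 _] := TM_cluster lam0 wt0 ltr01 zB zP; last by exists l.
move=> e e0.
have B0 : 0 <= B := le_trans (nrm_ge0 _ _) (zB 0%N).
have eB : 0 < e / (B + 1) by rewrite divr_gt0 //; lra.
have [K _ Ke] : \forall k \near \oo, (k.+1%:R^-1 : R) < e / (B + 1).
  have := cvgr_lt 0 (@cvg_harmonic R); apply; exact: eB.
exists K => k /Ke /= ke.
rewrite sub0r (nrmZ (tdotP n p ler01)) (nrmN (tdotP n p ler01)) gtr0_norm ?invr_gt0 //.
have h1 : (L k)^-1 <= k.+1%:R^-1 by rewrite lef_pV2 ?posrE // lerDr ltW.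
have h2 : (L k)^-1 * nrm (tdot 1) (z k) <= e / (B + 1) * B.
  apply: ler_pM; rewrite ?invr_ge0 ?nrm_ge0 ?(ltW (L_gt0 k)) //.
  exact: le_trans h1 (ltW ke).
apply: le_trans h2 _; have : e / (B + 1) * (B + 1) = e by rewrite divfK // gt_eqF //; lra.
by move: (e / (B + 1)) eB => t; lra.
Qed.

Lemma TM_zero_primal tau (z : triple) : TM tau z 0 -> primal_opt X y lam G wt z.1.2 z.2.
Proof.
case: z => [[w s] b] [/= h1 [/= h2 h3]]; rewrite add0r in h2; rewrite sub0r in h3.
rewrite scaler0 in h1.
have Xb : X *m b = y + s by apply/esym/eqP; rewrite -subr_eq0 -h1.
split=> [|s' b' h']; first by rewrite Xb addrK subrr.
have := h2 s'; have := h3 b'.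
rewrite (ipNl pP) dot_trmx mulmxBr Xb.
have -> : X *m b' = y + s'.
  by apply/eqP; rewrite -subr_eq0 opprD addrA addrAC h'.
by rewrite opprD addrACA subrr add0r; lra.
Qed.

Lemma TM_zero_dual tau (z : triple) : TM tau z 0 -> dual_opt X y lam G wt z.1.1.
Proof.
case: z => [[w s] b] [/= h1 [/= h2 h3]]; rewrite add0r in h2; rewrite sub0r in h3.
rewrite scaler0 in h1.
have Xb : X *m b = y + s by apply/esym/eqP; rewrite -subr_eq0 -h1.
(* This value separates the two sides: Fenchel-Young at [s] and [b] puts it below the dual objective
   everywhere, and the subgradient conditions give the reverse bound at [w]. *)
move=> w'; apply: (@le_trans _ _ (- Lrank s - lam * Psi G wt b)%:E).
- have c1 : (conj (@Lrank R n) w <= (dot w s - Lrank s)%:E)%E.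
    apply: ge_ereal_sup => _ [u _ <-]; rewrite lee_fin.
    by have := h2 u; rewrite !(ipE nP); lra.
  have c2 : (conj (Psi G wt) (- (lam^-1 *: (X^T *m w)))
      <= (dot (- (lam^-1 *: (X^T *m w))) b - Psi G wt b)%:E)%E.
    apply: ge_ereal_sup => _ [u _ <-]; rewrite lee_fin -(ler_pM2l lam0).
    have := h3 u; rewrite !(ipNl pP) !(ipZl pP) !(ipDr pP) !(ipNr pP).
    by rewrite !mulrBr !mulrN !mulVKf ?gt_eqF //; lra.
  apply: le_trans (leeD (leeD (lexx _) c1) (lee_wpmul2l _ c2)) _.
    by rewrite lee_fin ltW.
  rewrite -EFinM -!EFinD lee_fin (ipNl pP) (ipZl pP) dot_trmx Xb (ipDr nP).
  by rewrite mulrBr mulrN mulVKf ?gt_eqF // (ipC nP y); lra.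
- have c1 : ((dot w' s - Lrank s)%:E <= conj (@Lrank R n) w')%E.
    by apply: ereal_sup_ubound; exists s.
  have c2 : ((dot (- (lam^-1 *: (X^T *m w'))) b - Psi G wt b)%:E
      <= conj (Psi G wt) (- (lam^-1 *: (X^T *m w'))))%E.
    by apply: ereal_sup_ubound; exists b.
  apply: le_trans (leeD (leeD (lexx _) c1) (lee_wpmul2l _ c2)); last first.
    by rewrite lee_fin ltW.
  rewrite -EFinM -!EFinD lee_fin (ipNl pP) (ipZl pP) dot_trmx Xb (ipDr nP).
  by rewrite mulrBr mulrN mulVKf ?gt_eqF // (ipC nP y); lra.
Qed.

End KKT.

(** * Error bound and conclusion *)

Section Distances.
Set Implicit Arguments.
Unset Strict Implicit.
Variables (R : realType) (n p g : nat) (X : 'M[R]_(n, p)) (y : 'cV[R]_n).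
Variables (lam : R) (G : 'I_g -> {set 'I_p}) (wt : 'I_g -> R).
Hypothesis lam0 : 0 < lam.
Hypothesis wt0 : forall l, 0 < wt l.
Hypothesis cover : forall i : 'I_p, exists l, i \in G l.
Local Notation triple := (triple R n p).
Local Notation TM := (TM X y lam G wt).
Local Notation Om := (Tinv0 X y lam G wt).
Local Notation d tau := (zero_dist (tdot tau) (TM tau)).

Lemma distE z : dist z Om = d 1 z.
Proof.
rewrite /dist /zero_dist Tinv0E; congr inf; apply: eq_imagel => z' _.
by rewrite tnormE tsubE.
Qed.

Lemma distME tau z : 0 <= tau -> distM tau z Om = d tau z.
Proof.
move=> t0; rewrite /distM /zero_dist Tinv0E; congr inf; apply: eq_imagel => z' _.
by rewrite MnormE // tsubE.
Qed.

Lemma zero_dist_tau_le tau z : 0 < tau -> d tau z <= Num.sqrt (Num.max 1 tau) * d 1 z.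
Proof.
move=> t0; have g0 : 0 < Num.sqrt (Num.max 1 tau) by rewrite sqrtr_gt0 lt_max ltr01.
rewrite -ler_pdivrMl //; apply: zero_dist_ge; first exact: TM_zero_ex.
move=> z' z0; rewrite ler_pdivrMl //.
apply: le_trans (Mnorm_le_tnorm _ (ltW t0)).
by apply: zero_dist_le; move: z0; rewrite /TM /Mmul /= !scaler0.
Qed.

(* One factor sqrt(gamma) compares M^-1 with the identity on residuals, the other
   one compares the M-distance (or, outside the Euclidean ball, the radius of the
   M-ball) with its Euclidean counterpart. *)
Lemma error_bound_tau tau r kappa q v : 0 < tau -> 0 < kappa ->
  (forall z : triple, dist z Om <= r ->
     dist z Om <= kappa * dist0 (Top X y lam G wt z)) ->
  TM tau q v -> d tau q <= Num.sqrt (Num.max 1 tau) * r ->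
  d tau q <= kappa * Num.max 1 tau * nrm (tdot tau) v.
Proof.
move=> t0 k0 EB qv qr.
have EB1 z u : TM 1 z u -> d 1 z <= r -> d 1 z <= kappa * nrm (tdot 1) u.
  move=> zu; rewrite -distE => /EB /le_trans; apply.
  rewrite ler_pM2l //; apply: ge_inf; last first.
    by exists (Mmul 1 u) => //; rewrite tnormE /Mmul scale1r -!surjective_pairing.
  by exists 0 => _ [x _ <-]; exact: sqrtr_ge0.
set s := Num.sqrt _ in qr *.
have s0 : 0 < s by rewrite sqrtr_gt0 lt_max ltr01.
have ss : Num.max 1 tau = s * s by rewrite -expr2 sqr_sqrtr // le_max ler01.
have qu : TM 1 q (Mmul tau v).
  by move: qv; rewrite /TM {2}/Mmul scale1r -!surjective_pairing.
have h : kappa * nrm (tdot 1) (Mmul tau v) <= kappa * (s * nrm (tdot tau) v).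
  by rewrite ler_pM2l // tnorm_Mmul_le // ltW.
have -> : kappa * Num.max 1 tau * nrm (tdot tau) v
    = s * (kappa * (s * nrm (tdot tau) v)) by rewrite ss; ring.
have [qr1|qr1] := leP (d 1 q) r.
  apply: le_trans (zero_dist_tau_le q t0) _; rewrite -/s ler_pM2l //.
  exact: le_trans (EB1 _ _ qu qr1) h.
apply: le_trans qr _; rewrite ler_pM2l //; apply: le_trans h.
apply: (error_bound_extension (tdotP n p ler01) _ _ _ _ k0 EB1 qu qr1).
- by move=> q1 v1 q2 v2 h1 h2; exact (TM_monotone h1 h2).
- by move=> sg q' sg0; exact: (TM_resolvent X y G lam0 wt0 q' sg0 ltr01).
- by move=> zz vv BB h1 h2 h3; exact (TM_cluster lam0 wt0 ltr01 h1 h2 h3).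
- exact: TM_zero_ex.
Qed.

End Distances.

Theorem theorem2 (R : realType) (n p g : nat)
  (X : 'M[R]_(n, p)) (y : 'cV[R]_n) (lam : R)
  (G : 'I_g -> {set 'I_p}) (wt : 'I_g -> R)
  (w : nat -> 'cV[R]_n) (s : nat -> 'cV[R]_n) (b : nat -> 'cV[R]_p)
  (sigma : nat -> R) (tau : R) (delta : nat -> R) :
  (* standing assumptions *)
  0 < lam ->
  (forall l, G l != finset.set0) ->
  (forall l l', l != l' -> G l :&: G l' = finset.set0) ->
  (forall i : 'I_p, exists l, i \in G l) ->
  (forall l, 0 < wt l) ->
  (* parameters of the algorithm *)
  0 < sigma 0%N -> 0 < tau ->
  (forall k, 0 < delta k) -> (forall k, delta k < 1) ->
  cvgn (series delta) ->
  (forall k, sigma k <= sigma k.+1) ->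
  (* iterations *)
  (forall k, s k.+1 = sigma k *: prox 1 (@Lrank R n) ((sigma k)^-1 *: s k + w k.+1)) ->
  (forall k, b k.+1 = (sigma k * lam) *:
       prox 1 (Psi G wt) ((sigma k * lam)^-1 *: b k - lam^-1 *: (X^T *m w k.+1))) ->
  (forall k,
     let psik := fun v => auglag X y lam G wt (sigma k) (s k) (b k) v
                          + tau / (2 * sigma k) * enorm (v - w k) ^+ 2 in
     enorm (grad psik (w k.+1))
       <= delta k * Num.min 1 (Num.sqrt tau) / sigma k
          * Num.min 1 (Mnorm tau (tsub (w k.+1, s k.+1, b k.+1) (w k, s k, b k)))) ->
  (* conclusions *)
  ((exists sstar bstar, primal_opt X y lam G wt sstar bstar /\
      s @ \oo --> sstar /\ b @ \oo --> bstar) /\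
   (exists wstar, dual_opt X y lam G wt wstar /\ w @ \oo --> wstar)) /\
  (forall r kappa : R,
     limn (series delta) < r -> 0 < kappa ->
     (forall z : triple R n p, dist z (Tinv0 X y lam G wt) <= r ->
        dist z (Tinv0 X y lam G wt) <= kappa * dist0 (Top X y lam G wt z)) ->
     dist (w 0%N, s 0%N, b 0%N) (Tinv0 X y lam G wt)
       <= r - limn (series delta) ->
     forall k,
       let gamma := Num.max 1 tau in
       let mu := (1 - delta k)^-1 * (delta k + (1 + delta k) * kappa * gamma
                    / Num.sqrt (sigma k ^+ 2 + kappa ^+ 2 * gamma ^+ 2)) in
       distM tau (w k.+1, s k.+1, b k.+1) (Tinv0 X y lam G wt)
         <= mu * distM tau (w k, s k, b k) (Tinv0 X y lam G wt)).
Proof.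
move=> lam0 _ _ cover wt0 sigma0 tau0 delta0 delta1 delta_sum sigma_mono sE bE gE.
pose z k : triple R n p := (w k, s k, b k).
pose e k : triple R n p :=
  ((sigma k / tau) *: grad (psi X y lam G wt (sigma k) tau (z k)) (w k.+1), 0, 0).
have nP := @dotP R n; have tP := tdotP n p (ltW tau0).
have sg0 k : 0 < sigma k := sigma_gt0 sigma0 sigma_mono k.
have step k : resolvent (TM X y lam G wt tau) (sigma k) (z k + e k) (z k.+1).
  refine (@step_TM R n p g X y lam G wt lam0 wt0 (sigma k) tau (z k) (sg0 k) tau0
    (w k.+1) (s k.+1) (b k.+1) _ _) => /=.
  - have sE' : (sigma k)^-1 *: (s k + sigma k *: w k.+1) = (sigma k)^-1 *: s k + w k.+1.
      by rewrite scalerDr scalerA mulVf ?scale1r // gt_eqF.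
    by rewrite sE -sE'; apply: is_prox_homo => //; exact: sublinear_Lrank.
  - have bE' : (sigma k * lam)^-1 *: (b k - sigma k *: (X^T *m w k.+1))
        = (sigma k * lam)^-1 *: b k - lam^-1 *: (X^T *m w k.+1).
      rewrite scalerBr scalerA; congr (_ - _ *: _).
      by field; rewrite !gt_eqF.
    by rewrite bE -bE'; apply: is_prox_homo; [exact: sublinear_Psi | exact: mulr_gt0].
(* In the M-norm the perturbation is [sigma k / Num.sqrt tau] times the gradient norm; the factor
   [Num.min 1 (Num.sqrt tau)] of the stopping rule absorbs [Num.sqrt tau]. *)
have eN k : nrm (tdot tau) (e k)
    <= delta k * Num.min 1 (nrm (tdot tau) (z k.+1 - z k)).
  have st0 : 0 < Num.sqrt tau by rewrite sqrtr_gt0.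
  have st2 : Num.sqrt tau ^+ 2 = tau by rewrite sqr_sqrtr // ltW.
  have -> : nrm (tdot tau) (e k) = sigma k / Num.sqrt tau
      * enorm (grad (psi X y lam G wt (sigma k) tau (z k)) (w k.+1)).
    rewrite /nrm /tdot /= !(ip0l (@dotP R _)) !addr0 sqrtrM ?(ltW tau0) //.
    rewrite -/(enorm _) enormZ gtr0_norm ?divr_gt0 //.
    have -> : sigma k / tau = sigma k / Num.sqrt tau / Num.sqrt tau.
      by rewrite -{1}st2 expr2 invfM mulrA.
    move: (enorm _) (Num.sqrt tau) st0 => c a a0.
    by field; rewrite gt_eqF.
  have := gE k => /=; rewrite tsubE (MnormE _ (ltW tau0)) => ge.
  have M0 : 0 <= Num.min 1 (nrm (tdot tau) (z k.+1 - z k)) by rewrite le_min ler01 nrm_ge0.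
  apply: (@le_trans _ _ (sigma k / Num.sqrt tau * (delta k * Num.min 1 (Num.sqrt tau) / sigma k
      * Num.min 1 (nrm (tdot tau) (z k.+1 - z k))))).
    by rewrite ler_pM2l // divr_gt0.
  have m1 : Num.min 1 (Num.sqrt tau) <= Num.sqrt tau by rewrite ge_min lexx orbT.
  have aux (c a d m M : R) : 0 < c -> 0 < a -> 0 <= d -> 0 <= M -> m <= a ->
      c / a * (d * m / c * M) <= d * M.
    move=> c0 a0 d0 hM ma.
    have -> : c / a * (d * m / c * M) = m / a * (d * M) by field; rewrite !gt_eqF.
    by rewrite ler_piMl ?mulr_ge0 // ler_pdivrMr // mul1r.
  by apply: aux => //; exact: ltW.
have eD k : nrm (tdot tau) (e k) <= delta k.
  by apply: le_trans (eN k) _; rewrite ler_piMr ?(ltW (delta0 k)) // ge_min lexx.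
have mono z1 v1 z2 v2 (h1 : TM X y lam G wt tau z1 v1) (h2 : TM X y lam G wt tau z2 v2) :
  0 <= tdot tau (v1 - v2) (z1 - z2) := TM_monotone h1 h2.
have res sg q (h : 0 < sg) := TM_resolvent X y G lam0 wt0 q h tau0.
have zero := TM_zero_ex X y lam0 wt0 cover tau.
split.
  have [l l0 lP] : exists2 l, TM X y lam G wt tau l 0 & forall eps, 0 < eps ->
      exists K : nat, forall k : nat, (K <= k)%N -> nrm (tdot tau) (z k - l) <= eps.
    apply: (@inexact_ppa_cvg _ _ (tdot tau) tP (TM X y lam G wt tau) mono _ zero
      z e sigma delta sigma0 sigma_mono delta_sum _ eD step).
    - by move=> zz vv BB h1 h2 h3; exact (TM_cluster lam0 wt0 tau0 h1 h2 h3).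
    - by move=> k; exact: ltW.
  split.
    exists l.1.2, l.2; split; first exact (TM_zero_primal l0).
    split; apply: enorm_cvg => eps eps0; have [K KP] := lP eps eps0; exists K => k Kk;
      apply: le_trans (KP k Kk); by have [] := tdot_components (z k - l) tau0.
  exists l.1.1; split; first exact (TM_zero_dual lam0 l0).
  apply: enorm_cvg => eps eps0.
  have st0 : 0 < Num.sqrt tau by rewrite sqrtr_gt0.
  have [K KP] := lP (Num.sqrt tau * eps) (mulr_gt0 st0 eps0); exists K => k Kk.
  have [h _ _] := tdot_components (z k - l) tau0; apply: le_trans h _.
  by rewrite ler_pdivrMl // KP.
move=> r kappa Sr k0 EB d0r k; cbv zeta; set gamma := Num.max 1 tau.
have g1 : 1 <= gamma by rewrite le_max lexx.
have g0 : 0 < gamma by lra.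
have sg1 : 1 <= Num.sqrt gamma by rewrite -[leLHS]sqrtr1 ler_wsqrtr.
rewrite !distME ?(ltW tau0) //.
have -> : (1 + delta k) * kappa * gamma = (1 + delta k) * (kappa * gamma) by rewrite mulrA.
rewrite -exprMn.
apply: (@inexact_ppa_rate _ _ (tdot tau) tP (TM X y lam G wt tau) mono res zero
  _ _ _ (z k) (z k.+1) (e k)) => //.
- by rewrite mulr_gt0.
- apply: le_trans (eN k) _; rewrite ler_pM2l // ge_min lexx orbT //.
(* With [S] the sum of the errors, the M-distance of [z k] is at most
   [Num.sqrt gamma * (r - S) + S], hence at most [Num.sqrt gamma * r] because
   [Num.sqrt gamma >= 1]. *)
- move=> q v qv qz; apply: (error_bound_tau lam0 wt0 cover tau0 k0 EB qv).
  apply: le_trans qz _; rewrite -/gamma.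
  have S_ge0 : 0 <= limn (series delta).
    have := series_delta_le delta_sum (fun k => ltW (delta0 k)) 0.
    by rewrite /series /= big_geq.
  have h1 : zero_dist (tdot tau) (TM X y lam G wt tau) (z k)
      <= zero_dist (tdot tau) (TM X y lam G wt tau) (z 0%N) + limn (series delta).
    rewrite -lerBlDr; apply: zero_dist_ge => // x x0; rewrite lerBlDr.
    apply: le_trans (zero_dist_le _ (z k) x0) _.
    have := inexact_ppa_fejer tP mono sigma0 sigma_mono eD step x0 (leq0n k).
    have := series_delta_le delta_sum (fun k => ltW (delta0 k)) k.
    by rewrite {4}/series /= big_geq //; lra.
  have h2 := zero_dist_tau_le X y lam0 wt0 cover (z 0%N) tau0.
  move: d0r; rewrite distE => d0r; apply: le_trans h1 _.
  rewrite -/gamma in h2; move: (Num.sqrt gamma) sg1 h2 => sg sg1 h2.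
  have : sg * zero_dist (tdot 1) (TM X y lam G wt 1) (z 0%N)
      <= sg * (r - limn (series delta)) by rewrite ler_pM2l //; lra.
  by move: (limn (series delta)) S_ge0 => S S0; nra.
Qed.
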